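(* Let $r\ge1$, let $2\le m_1\le\cdots\le m_r$ be integers, and let $S\subset D_r^{\mathbb{N}}$ be a sofic system defined by a finite directed graph $G$ with a right-resolving labelling of its edges by $D_r$. Suppose that the adjacency matrix $A$ of $G$ is primitive, meaning that some power of $A$ has all entries positive. Then the sofic set $X=R(S)\subset\mathbb{T}^r$ has Minkowski dimension $$\dim_{\mathrm M}(X)=\frac{1}{\log m_r}h_{\mathrm{top}}(S,\sigma)+\sum_{i=1}^{r-1}\left(\frac1{\log m_i}-\frac1{\log m_{i+1}}\right)h_{\mathrm{top}}(S^{(i)},\sigma),$$ where $\sigma$ is the left-shift map. Moreover $h_{\mathrm{top}}(S,\sigma)=\log\rho(A)$, where $\rho(A)$ is the spectral radius of $A$.
   Context: Let $I_i=\{0,1,\dots,m_i-1\}$ and $D_i=I_1\times\cdots\times I_i$ for $1\le i\le r$. The map $R:D_r^{\mathbb{N}}\to\mathbb{T}^r=\mathbb{R}^r/\mathbb{Z}^r$ is $R\left((e^{(n)}_1,\dots,e^{(n)}_r)_{n\ge1}\right)=\left(\sum_{k=1}^\infty e_1^{(k)}m_1^{-k},\dots,\sum_{k=1}^\infty e_r^{(k)}m_r^{-k}\right)$. $\mathbb{T}^r$ carries its standard flat metric and $\dim_{\mathrm M}$ is Minkowski (box-counting) dimension. Sofic system: let $G=\langle V,E\rangle$ be a finite directed graph, loops and multiple edges allowed, whose edges are labelled by elements of $D_r$ in a right-resolving fashion, i.e. any two distinct edges emanating from the same vertex have different labels. The set $S\subset D_r^{\mathbb{N}}$ of label sequences of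 infinite paths in $G$ is the sofic system defined by $G$, and $R(S)$ is the associated sofic set. The adjacency matrix $A$ has as $(i,j)$ entry the number of edges from vertex $v_i$ to vertex $v_j$. Set $S^{(r)}=S$, and for $1\le i\le r-1$ let $S^{(i)}\subset D_i^{\mathbb{N}}$ be the image of $S$ under the map keeping only the first $i$ components of each symbol: $(e^{(n)}_1,\dots,e^{(n)}_r)_n\mapsto(e^{(n)}_1,\dots,e^{(n)}_i)_n$. $h_{\mathrm{top}}$ denotes topological entropy of the shift $\sigma(e^{(1)},e^{(2)},\dots)=(e^{(2)},e^{(3)},\dots)$ on these sets. *)

(* Defs.v *)
(* MathComp and MathComp-Analysis, over an arbitrary R : realType. *)
From HB Require Import structures.
From mathcomp Require Export all_boot all_order all_algebra.
From mathcomp Require Export all_classical all_reals all_analysis.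
From mathcomp Require Import complex.

Set Implicit Arguments.
Unset Strict Implicit.
Unset Printing Implicit Defensive.

Import Order.TTheory GRing.Theory Num.Theory.
Import numFieldNormedType.Exports.

Local Open Scope classical_set_scope.
Local Open Scope ring_scope.
Local Open Scope quotient_scope.

(* Least number of members of the family W needed to cover K; +oo if no finite
   subfamily covers K. *)
Definition cover_number (R : realType) (T : Type) (K : set T)
    (W : set (set T)) : \bar R :=
  ereal_inf [set (N%:R)%:E | N in [set N : nat |
    exists2 F : 'I_N -> set T,
      (forall i, W (F i)) & K `<=` \bigcup_i F i]].

Definition closed_balls (R : realType) (T : Type) (d : T -> T -> R) (e : R) :
    set (set T) :=
  [set [set q | d p q <= e] | p in [set: T]].

(* Existence of the limit of log N(e) / log (1/e) is part of the assertion. *)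
Definition has_minkowski_dim (R : realType) (T : Type) (d : T -> T -> R)
    (X : set T) (s : \bar R) : Prop :=
  (lne (cover_number R X (closed_balls d e)) * ((ln e^-1)^-1)%:E)%E
    @[e --> 0^'+] --> s.

Definition open_cover (X : topologicalType) (K : set X)
    (U : set (set X)) : Prop :=
  (forall O, U O -> open O) /\ K `<=` \bigcup_(O in U) O.

(* The join of U, f^-1 U, ..., f^-(n-1) U. *)
Definition join_cover (X : Type) (f : X -> X) (U : set (set X)) (n : nat) :
    set (set X) :=
  [set \bigcap_(k in `I_n) (iter k f @^-1` w k) |
    w in [set w : nat -> set X | forall k, (k < n)%N -> U (w k)]].

(* The limit superior is a limit, by subadditivity, when f maps K into K. *)
Definition cover_entropy (R : realType) (X : Type) (f : X -> X) (K : set X)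
    (U : set (set X)) : \bar R :=
  limn_esup (fun n =>
    (n%:R^-1)%:E * lne (cover_number R K (join_cover f U n)))%E.

(* Topological entropy (Adler-Konheim-McAndrew) of the restriction of f to an
   invariant subset K; the open covers of the subspace K are the traces on K of
   families of open sets of X that cover K. *)
Definition top_entropy (R : realType) (X : topologicalType) (f : X -> X)
    (K : set X) : \bar R :=
  ereal_sup [set cover_entropy R f K U | U in open_cover K].

(* m is indexed from 1, as m_1, ..., m_r; the value m 0 is irrelevant. *)
Definition digits (m : nat -> nat) (i : nat) : finType :=
  {dffun forall j : 'I_i, 'I_(m j.+1)}.

(* x k is the (k+1)-st symbol of x. *)
Definition digit_seq (m : nat -> nat) (i : nat) : topologicalType :=
  {ptws nat -> discrete_topology (digits m i)}.

Definition shift (m : nat -> nat) (i : nat) (x : digit_seq m i) :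
    digit_seq m i := fun k => x k.+1.

Definition trunc_digits (m : nat -> nat) (r i : nat) (le_ir : (i <= r)%N)
    (e : digits m r) : digits m i :=
  finfun (fun j : 'I_i => e (widen_ord le_ir j) : 'I_(m j.+1)).

Definition trunc_seq (m : nat -> nat) (r i : nat) (le_ir : (i <= r)%N)
    (x : digit_seq m r) : digit_seq m i := fun k => trunc_digits le_ir (x k).

Section Torus.
Variables (R : realType) (r : nat).

Definition int_cong (x y : 'rV[R]_r) : bool :=
  [forall j, x 0 j - y 0 j \is a Num.int].

Lemma int_cong_refl : reflexive int_cong.
Proof. by move=> x; apply/forallP => j; rewrite subrr rpred0. Qed.

Lemma int_cong_sym : symmetric int_cong.
Proof.
by move=> x y; apply: eq_forallb => j; rewrite -opprB rpredN.
Qed.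

Lemma int_cong_trans : transitive int_cong.
Proof.
move=> y x z /forallP xy /forallP yz; apply/forallP => j.
by rewrite -(subrK (y 0 j) (x 0 j)) -addrA rpredD.
Qed.

Canonical int_cong_equiv :=
  EquivRel int_cong int_cong_refl int_cong_sym int_cong_trans.

Definition torus : Type := {eq_quot int_cong_equiv}.

Definition torus_proj (x : 'rV[R]_r) : torus := \pi_({eq_quot int_cong_equiv}) x.

(* The library norm on 'rV_r is the sup norm. *)
Definition euclidean_dist (x y : 'rV[R]_r) : R :=
  Num.sqrt (\sum_j (x 0 j - y 0 j) ^+ 2).

Definition flat_dist (p q : torus) : R :=
  inf [set euclidean_dist z.1 z.2 |
    z in [set z : 'rV[R]_r * 'rV[R]_r | torus_proj z.1 = p /\ torus_proj z.2 = q]].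

Definition digit_map (m : nat -> nat) (x : digit_seq m r) : torus :=
  torus_proj (\row_(j < r)
    limn (series (fun k => ((x k : digits m r) j)%:R / (m j.+1)%:R ^+ k.+1 : R))).

End Torus.

Record labelled_graph (L : Type) := LabelledGraph {
  vertex : finType;
  edge : finType;
  src : edge -> vertex;
  tgt : edge -> vertex;
  label : edge -> L
}.

Definition right_resolving (L : Type) (G : labelled_graph L) : Prop :=
  forall e1 e2 : edge G, src e1 = src e2 -> label e1 = label e2 -> e1 = e2.

Definition sofic_system (m : nat -> nat) (r : nat)
    (G : labelled_graph (digits m r)) : set (digit_seq m r) :=
  [set x | exists2 p : nat -> edge G,
    (forall k, tgt (p k) = src (p k.+1)) & x = (fun k => label (p k))].

Definition adjacency (R : realType) (L : Type) (G : labelled_graph L) :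
    'M[R]_#|vertex G| :=
  \matrix_(i, j)
    #|[set e : edge G | (src e == enum_val i) && (tgt e == enum_val j)]%SET|%:R.

(* The zeroth power is excluded: it would make the 1 x 1 zero matrix primitive. *)
Definition primitive_mx (R : realType) (n : nat) (A : 'M[R]_n) : Prop :=
  exists2 k : nat, (0 < k)%N & forall i j, 0 < (A ^+ k) i j.

Definition spectral_radius (R : realType) (n : nat) (A : 'M[R]_n) : R :=
  sup [set ComplexField.Normc.normc z |
    z in [set z : R[i]%C | eigenvalue (map_mx (real_complex R) A) z]].

(* Main.v *)
(** Specifying the first L_j digits in base m_j of the j-th coordinate, with
    m_j^(-L_j) of order e (so L_1 >= ... >= L_r), cuts the torus into
    approximate cubes of side e.  A ball of radius e meets boundedly many of
    them, so the covering number of R(S) at scale e is, up to a bounded factor,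
    the number of approximate cubes met by R(S).  Such a cube is a word of length
    L_r of S^(r), followed by a word of length L_(r-1) - L_r of S^(r-1), and so
    on, down to a word of length L_1 - L_2 of S^(1).  Shift invariance bounds the
    number of cubes by the product of the numbers of these words; primitivity
    allows words to be glued with gaps of bounded length, which gives the
    converse bound up to a constant.  The number of words of length n of S^(i)
    is submultiplicative in n and grows like exp (n h_top(S^(i))), whence the
    formula.

    By right-resolvingness the number of words of length n of S is, up to the
    factor #|V|, the sum of the entries of A^n.  This sum is at least rho(A)^n,
    by looking at an eigenvector; conversely primitivity bounds it by a constant
    times tr A^(n+k), and the trace of A^(n+k) is at most #|V| rho(A)^(n+k). *)
Require Import Defs.
From mathcomp Require Import complex.
From mathcomp Require Import ring lra zify.

Set Implicit Arguments.
Unset Strict Implicit.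
Unset Printing Implicit Defensive.

Import Order.TTheory GRing.Theory Num.Theory.
Import numFieldNormedType.Exports.

Local Open Scope classical_set_scope.
Local Open Scope ring_scope.

(** * Counting values *)

(** Words, cubes and path prefixes are all counted through it: the points stay infinite sequences,
    and finiteness comes from the codomain. *)
Definition nvals (X : Type) (T : finType) (K : set X) (F : X -> T) : nat :=
  #|[pred t : T | `[< exists2 x, K x & F x = t >]]|.

(** Since [F' (g x)] determines [F x], a choice of one preimage per value of [F] embeds the values
    of [F] into those of [F']. *)
Lemma leq_nvals (X X' : Type) (T T' : finType) (K : set X) (K' : set X')
    (F : X -> T) (F' : X' -> T') (g : X -> X') :
  (forall x, K x -> K' (g x)) ->
  (forall x y, K x -> K y -> F' (g x) = F' (g y) -> F x = F y) ->
  (nvals K F <= nvals K' F')%N.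
Proof.
move=> KK' gF; rewrite /nvals; set A := [pred t | _]; set B := [pred t | _].
case: (posnP #|A|) => [->//|/card_gt0P[t0 At0]].
have /asboolP/cid2[x0 Kx0 _] := At0.
have /choice[h hP] : forall t, exists x, t \in A -> K x /\ F x = t.
  move=> t; have [/asboolP[x Kx Fx]|_] := boolP (t \in A); first by exists x.
  by exists x0.
rewrite -(card_in_image (f := fun t => F' (g (h t)))).
  apply: subset_leq_card; apply/fintype.subsetP => _ /fintype.imageP[t At ->].
  by apply/asboolP; exists (g (h t)) => //; apply: KK'; case: (hP _ At).
move=> s t As At e; have [Ks Es] := hP _ As; have [Kt Et] := hP _ At.
by rewrite -Es -Et; exact: gF.
Qed.

Lemma nvals_gt0 (X : Type) (T : finType) (K : set X) (F : X -> T) :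
  K !=set0 -> (0 < nvals K F)%N.
Proof.
by move=> [x Kx]; apply/card_gt0P; exists (F x); apply/asboolP; exists x.
Qed.

Lemma nvals_dffun (X : Type) (I : finType) (T : I -> finType) (K : I -> set X)
    (F : forall i, X -> T i) :
  \prod_i nvals (K i) (F i) =
  #|[pred t : {dffun forall i, T i} |
      [forall i, `[< exists2 x, K i x & F i x = t i >]]]|.
Proof.
pose P i : pred (T i) := [pred t | `[< exists2 x, K i x & F i x = t >]].
transitivity #|(family P : pred {dffun forall i, T i})|; last exact: eq_card.
by rewrite card_family foldrE big_map big_enum.
Qed.

Lemma nvals_le_prod (X : Type) (I : finType) (T : I -> finType) (K : set X)
    (F : forall i, X -> T i) :
  (nvals K (fun x => finfun (F ^~ x) : {dffun forall i, T i})
     <= \prod_i nvals K (F i))%N.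
Proof.
rewrite nvals_dffun; apply: subset_leq_card; apply/fintype.subsetP => t /asboolP[x Kx <-].
by apply/forallP => i; rewrite ffunE; apply/asboolP; exists x.
Qed.

(** In use, [F i] reads block [i] at its place in [x] and [F' i] reads it at the start of [q i]; the
    hypothesis is then the gluing of words. *)
Lemma prod_nvals_le (X : Type) (I : finType) (T : I -> finType) (K : set X)
    (K' : I -> set X) (F F' : forall i, X -> T i) :
  (forall q : I -> X, (forall i, K' i (q i)) ->
     exists2 x, K x & forall i, F i x = F' i (q i)) ->
  (\prod_i nvals (K' i) (F' i) <=
   nvals K (fun x => finfun (F ^~ x) : {dffun forall i, T i}))%N.
Proof.
move=> glue; rewrite nvals_dffun; apply: subset_leq_card; apply/fintype.subsetP => t /forallP tP.
have /choice[q qP] : forall i, exists x, K' i x /\ F' i x = t i.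
  by move=> i; have /asboolP[x Kx Fx] := tP i; exists x.
have [|x Kx xE] := glue q; first by move=> i; case: (qP i).
apply/asboolP; exists x => //; apply/ffunP => i.
by rewrite ffunE xE; case: (qP i).
Qed.

Lemma nvals_image (X Y : Type) (T : finType) (K : set X) (g : X -> Y)
    (F : Y -> T) : nvals (g @` K) F = nvals K (F \o g).
Proof.
apply: eq_card => t; apply/asboolP/asboolP => [[_ [x Kx <-] <-]|[x Kx <-]].
  by exists x.
by exists (g x) => //; exists x.
Qed.

(** * Paths of the graph *)

Lemma nvals_partition (X : Type) (T I : finType) (K : set X) (F : X -> T)
    (c : X -> I) :
  (forall x y, K x -> K y -> F x = F y -> c x = c y) ->
  nvals K F = (\sum_i nvals (K `&` [set x | c x = i]) F)%N.
Proof.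
move=> Fc; rewrite /nvals; set A := [pred t | _].
case: (pselect (exists t, t \in A)) => [[t0 /asboolP/cid2[x0 Kx0 _]]|A0]; last first.
  rewrite (eq_card0 (A := A)) => [|t]; last by apply/negP => At; apply: A0; exists t.
  rewrite big1 // => i _; apply: eq_card0 => t; apply/negP => /asboolP[x [Kx _] Fx].
  by apply: A0; exists t; apply/asboolP; exists x.
have /choice[h hP] : forall t, exists x, t \in A -> K x /\ F x = t.
  move=> t; have [/asboolP[x Kx Fx]|_] := boolP (t \in A); first by exists x.
  by exists x0.
rewrite -sum1_card (partition_big (fun t => c (h t)) predT) //=.
apply: eq_bigr => i _; rewrite -sum1_card; apply: eq_bigl => t; rewrite !inE.
apply/andP/asboolP => [[At /eqP <-]|[x [Kx <-] Fx]].
  by exists (h t); case: (hP t At).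
have At : t \in A by apply/asboolP; exists x.
by split=> //; have [Kh Fh] := hP t At; apply/eqP/Fc => //; rewrite Fh.
Qed.

Definition ocons (X : Type) (a : X) (x : nat -> X) (k : nat) : X :=
  if k is k'.+1 then x k' else a.

Definition prefix_of (T : finType) (n : nat) (x : nat -> T) : {ffun 'I_n -> T} :=
  [ffun k : 'I_n => x k].

Lemma prefix_ofP (T : finType) (n : nat) (x y : nat -> T) :
  prefix_of n x = prefix_of n y <-> (forall k, (k < n)%N -> x k = y k).
Proof.
split=> [/ffunP xy k kn|xy]; first by have := xy (Ordinal kn); rewrite !ffunE.
by apply/ffunP => k; rewrite !ffunE xy.
Qed.

Section Paths.
Variables (L : Type) (G : labelled_graph L).

Definition is_path (p : nat -> edge G) := forall k, tgt (p k) = src (p k.+1).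

Definition paths_from (u : vertex G) : set (nat -> edge G) :=
  [set p | is_path p /\ src (p 0) = u].

(** The form in which primitivity enters. One [k] for all vertices and paths keeps the gaps between
    glued words of constant length. *)
Definition prepends (k : nat) := forall u (q : nat -> edge G), is_path q ->
  exists p, [/\ is_path p, src (p 0) = u & forall t, p (k + t)%N = q t].

Lemma is_path_ocons (a : edge G) p :
  is_path p -> src (p 0) = tgt a -> is_path (ocons a p).
Proof. by move=> pP ap [|k] //=. Qed.

Lemma glue_paths (k n : nat) (p q : nat -> edge G) :
  prepends k -> is_path p -> is_path q ->
  exists p', [/\ is_path p', forall t, (t < n)%N -> p' t = p t &
    forall t, p' (n + k + t)%N = q t].
Proof.
move=> kP; elim: n p => [|n IHn] p pP qP.
  by have [p' [? _ ?]] := kP (src (p 0)) q qP; exists p'.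
have [|p' [p'P p'p p'q]] := IHn (fun t => p t.+1) _ qP; first by move=> t; exact: pP.
(* For [n = 0] the path [p'] of the induction hypothesis need not start at the end of [p 0], so [q]
   is joined to [p 0] directly. *)
have [p0|n0] := posnP n.
  have [p'' [p''P p''0 p''q]] := kP (tgt (p 0)) q qP.
  exists (ocons (p 0) p''); split; first exact: is_path_ocons.
    by rewrite p0 => -[].
  by move=> t; rewrite p0 /= -p''q.
exists (ocons (p 0) p'); split.
- by apply: is_path_ocons => //; rewrite p'p // pP.
- by move=> [|t] //= tn; rewrite p'p.
- by move=> t; rewrite /= -p'q.
Qed.

(* Leaving the gap of length k at the front of each block, rather than at its
   end, lets blocks shorter than k be skipped without further ado. *)
Lemma glue_blocks (k : nat) (off : nat -> nat) (p : nat -> edge G)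
    (q : nat -> nat -> edge G) (s : nat) :
  prepends k -> {homo off : i j / (i <= j)%N} -> is_path p ->
  (forall b, is_path (q b)) ->
  exists2 p', is_path p' & forall b t, (b < s)%N ->
    (off b + k + t < off b.+1)%N -> p' (off b + k + t)%N = q b t.
Proof.
move=> kP offP pP qP; elim: s => [|s [p' p'P p'q]]; first by exists p.
have [p'' [p''P p''p' p''q]] := glue_paths (off s) kP p'P (qP s).
exists p'' => // b t; rewrite ltnS leq_eqVlt => /predU1P[-> _|bs tb].
  exact: p''q.
by rewrite p''p' ?p'q // (leq_trans tb) // offP.
Qed.

End Paths.

(** * Powers of the adjacency matrix and paths *)

Section Adjacency.
Variables (R : realType) (L : Type) (G : labelled_graph L).
Let A := adjacency R G.

(** Summing over outgoing edges, parallel ones separately, lets powers of [A] be treated by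
    induction on the first edge of a path. *)
Lemma adjacency_mul (n : nat) (B : 'M[R]_(#|vertex G|, n)) u j :
  (A *m B) (enum_rank u) j = \sum_(e : edge G | src e == u) B (enum_rank (tgt e)) j.
Proof.
rewrite mxE (partition_big (fun e : edge G => enum_rank (tgt e)) predT) //=.
apply: eq_bigr => i _; rewrite mxE enum_rankK.
rewrite (eq_bigr (fun=> B i j)); last by move=> e /andP[_ /eqP ->].
rewrite sumr_const mulr_natl; congr (_ *+ _); apply: eq_card => e.
rewrite !inE /in_mem /=; congr (_ && _).
by rewrite -(inj_eq enum_rank_inj) enum_valK.
Qed.

Lemma adjacency_ge0 n i j : 0 <= (A ^+ n) i j.
Proof.
elim: n i => [|n IHn] i; first by rewrite expr0 mxE ler0n.
by rewrite exprS -(enum_valK i) adjacency_mul sumr_ge0.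
Qed.

Lemma adjacency_expP n u v :
  0 < (A ^+ n) (enum_rank u) (enum_rank v) ->
  forall q : nat -> edge G, is_path q -> src (q 0) = v ->
  exists p, [/\ is_path p, src (p 0) = u & forall t, p (n + t)%N = q t].
Proof.
elim: n u => [|n IHn] u.
  rewrite expr0 mxE ltr0n lt0b => /eqP/enum_rank_inj -> q qP q0.
  by exists q.
rewrite exprS adjacency_mul => ep q qP q0.
have [e /eqP eu /IHn] : exists2 e : edge G, src e == u &
    0 < (A ^+ n) (enum_rank (tgt e)) (enum_rank v).
  apply/exists_inP; apply: contraTT ep => /exists_inPn ep.
  by rewrite -leNgt sumr_le0 // => e /ep; rewrite -leNgt.
move=> /(_ q qP q0)[p [pP pe pq]].
exists (ocons e p); split=> //; exact: is_path_ocons.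
Qed.

Lemma primitive_prepends : primitive_mx A -> exists k, prepends G k.
Proof.
move=> [k k0 Ak]; exists k => u q qP.
exact: (@adjacency_expP k u (src (q 0)) _ q qP erefl).
Qed.

(** A vertex without outgoing edges has a zero row in every positive power of [A]. *)
Lemma primitive_out_edge : primitive_mx A ->
  forall u : vertex G, exists e : edge G, src e = u.
Proof.
move=> [[//|k] _ Ak] u; have := Ak (enum_rank u) (enum_rank u).
rewrite exprS adjacency_mul; case: (pickP (fun e : edge G => src e == u)).
  by move=> e /eqP <-; exists e.
by move=> e0; rewrite big_pred0 ?ltxx.
Qed.

Lemma primitive_path : primitive_mx A ->
  forall u : vertex G, exists p : nat -> edge G, is_path p /\ src (p 0) = u.
Proof.
move=> /primitive_out_edge/choice[nx nxP] u.
exists (fun n => nx (iter n (fun v => tgt (nx v)) u)); split=> [k|]; exact: esym.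
Qed.

(** Prefixes of infinite paths are all the finite paths, because primitivity leaves no dead ends.
    The induction splits by the first edge. *)
Lemma nvals_paths_from n u : primitive_mx A ->
  (nvals (paths_from u) (@prefix_of (edge G) n))%:R =
  (A ^+ n *m const_mx 1 : 'cV[R]__) (enum_rank u) 0.
Proof.
move=> primA; elim: n u => [|n IHn] u.
  have [p0 [p0P p0u]] := primitive_path primA u.
  rewrite expr0 mul1mx mxE (_ : nvals _ _ = 1%N)//.
  rewrite -[RHS](@card1 {ffun 'I_0 -> edge G} (prefix_of 0 p0)); apply: eq_card => f.
  rewrite !inE; apply/asboolP/eqP => [_|->]; last by exists p0.
  by apply/ffunP => -[].
rewrite exprS -mulmxA adjacency_mul.
rewrite (@nvals_partition _ _ _ _ _ (fun p => p 0%N)); last first.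
  by move=> x y _ _ /prefix_ofP; exact.
rewrite natr_sum [RHS]big_mkcond /=; apply: eq_bigr => e _; case: eqP => [<-|eu].
  rewrite -IHn; congr (_%:R); apply/eqP; rewrite eqn_leq; apply/andP; split.
    apply: (leq_nvals (g := fun p k => p k.+1)).
      by move=> p [[pP _] /= <-]; split; [move=> k; exact: pP|rewrite -pP].
    move=> p p' [_ /= pe] [_ /= p'e] /prefix_ofP pp'; apply/prefix_ofP => -[_|k kn].
      by rewrite pe.
    exact: pp'.
  apply: (leq_nvals (g := ocons e)).
    by move=> p [pP pe]; split=> //; split=> //; exact: is_path_ocons.
  move=> p p' _ _ /prefix_ofP pp'; apply/prefix_ofP => k kn.
  exact: (pp' k.+1 kn).
rewrite /nvals eq_card0 // => t; rewrite !inE; apply/negP => /asboolP[p [[_ pu] /= pe]].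
by rewrite -pe in eu.
Qed.

End Adjacency.

(** * Growth of the powers of a primitive matrix *)

Section Triangular.
Variables (C : numClosedFieldType) (n : nat).

Lemma trig_exp (T : 'M[C]_n) k : is_trig_mx T ->
  is_trig_mx (T ^+ k) /\ forall i, (T ^+ k) i i = T i i ^+ k.
Proof.
move=> /is_trig_mxP Ttrig; elim: k => [|k [/is_trig_mxP Tk Tkd]].
  by split=> [|i]; [exact: scalar_mx_is_trig|rewrite !expr0 mxE eqxx].
split=> [|i].
  apply/is_trig_mxP => i j ij; rewrite exprS mxE big1 // => l _.
  by have [il|li] := ltnP i l; [rewrite Ttrig ?mul0r|rewrite Tk ?mulr0 // (leq_ltn_trans li)].
rewrite exprS [LHS]mxE (bigD1 i) //= Tkd exprS big1 ?addr0 // => l li.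
have [il|li'] := ltnP i l; first by rewrite Ttrig ?mul0r.
by rewrite Tk ?mulr0 // ltn_neqAle li.
Qed.

(* By Schur triangularization, tr (A ^+ k) is the sum of the k-th powers of the
   eigenvalues. *)
Lemma norm_trace_exp_le (A : 'M[C]_n) (b : C) k :
  (forall z, eigenvalue A z -> `|z| <= b) ->
  `|\tr (A ^+ k)| <= n%:R * b ^+ k.
Proof.
move=> Ab; have [n0|n0] := posnP n.
  rewrite (_ : n%:R = 0 :> C) ?n0 // mul0r /mxtrace big1 ?normr0 // => i _.
  by exfalso; have := leq_ltn_trans (leq0n i) (ltn_ord i); rewrite n0.
have [P /unitarymx_unit Pu PT] := Schur A n0.
pose T := conjmx P A.
have PA : P *m A = T *m P by exact/(similarP Pu)/eqP.
have PAk : P *m A ^+ k = T ^+ k *m P.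
  elim: k => [|k IH]; first by rewrite !expr0 mulmx1 mul1mx.
  by rewrite !exprSr mulmxA IH -mulmxA PA mulmxA.
have -> : \tr (A ^+ k) = \tr (T ^+ k).
  by rewrite -[A ^+ k](mulKmx Pu) PAk mxtrace_mulC mulmxK.
have Tb i : `|T i i| <= b.
  apply: Ab; have : eigenvalue T (T i i).
    rewrite eigenvalue_root_char char_poly_trig // (bigD1 i) //=.
    by rewrite rootM root_XsubC eqxx.
  (* An eigenvector [v] of [T = P A P^-1] yields the eigenvector [v P] of [A]. *)
  move=> /eigenvalueP[v vT v0]; apply/eigenvalueP; exists (v *m P).
    by rewrite -mulmxA PA mulmxA vT scalemxAl.
  by apply: contraNneq v0 => vP; rewrite -[v](mulmxK Pu) vP mul0mx.
have [_ Tkd] := trig_exp k PT.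
rewrite /mxtrace (eq_bigr (fun i => T i i ^+ k)) //.
have -> : n%:R * b ^+ k = \sum_(i < n) b ^+ k by rewrite sumr_const card_ord mulr_natl.
apply: (le_trans (ler_norm_sum _ _ _)); apply: ler_sum => i _.
rewrite normrX; apply: lerXn2r; rewrite ?nnegrE ?normr_ge0 ?Tb //.
exact: le_trans (Tb i).
Qed.
End Triangular.

Lemma normc_ge0 (R : rcfType) (z : R[i]%C) : 0 <= ComplexField.Normc.normc z.
Proof. by case: z => a b; exact: sqrtr_ge0. Qed.

(** * Entry sums of powers against the spectral radius *)

Section NonnegMatrix.
Variables (R : realType) (n : nat) (A : 'M[R]_n).
Let Ac : 'M[R[i]%C]_n := map_mx (real_complex R) A.
Let rho := spectral_radius A.
Let total k : R := \sum_i \sum_j (A ^+ k) i j.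

Lemma map_mx_exp k : Ac ^+ k = map_mx (real_complex R) (A ^+ k).
Proof.
elim: k => [|k IH]; first by rewrite !expr0 map_mx1.
by rewrite !exprS IH [RHS](map_mxM (real_complex R) A (A ^+ k)).
Qed.

Hypothesis A_ge0 : forall k i j, 0 <= (A ^+ k) i j.

(** At a coordinate [j] where [|v_j|] is largest, [v A^k = z^k v] gives [|z|^k |v_j| <= sum_i |v_i|
    (A^k)_ij <= |v_j| total k]. *)
Lemma eigenvalue_le_total z k : eigenvalue Ac z ->
  ComplexField.Normc.normc z ^+ k <= total k.
Proof.
move=> /eigenvalueP[v vA v0].
have vAk : v *m Ac ^+ k = z ^+ k *: v.
  elim: k => [|k IH]; first by rewrite !expr0 mulmx1 scale1r.
  by rewrite exprSr mulmxA IH -scalemxAl vA scalerA -exprSr.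
have /rV0Pn[j0 vj0] := v0.
have [j _ jmax] := @arg_maxP _ _ _ j0 predT (fun j => ComplexField.Normc.normc (v 0 j)) isT.
have vj : 0 < ComplexField.Normc.normc (v 0 j).
  apply: lt_le_trans (jmax j0 isT).
  by rewrite -ltcR -[X in _ < X]/(`|v 0 j0|) normr_gt0.
rewrite -(ler_pM2l vj) -lecR !rmorphM rmorphXn /= -[X in X * _ ^+ _]/(`|v 0 j|).
rewrite -[X in _ * X ^+ _]/(`|z|) -normrX mulrC -normrM.
have -> : z ^+ k * v 0 j = (v *m Ac ^+ k) 0 j by rewrite vAk mxE.
rewrite mxE map_mx_exp; apply: (le_trans (ler_norm_sum _ _ _)).
rewrite /total rmorph_sum mulr_sumr; apply: ler_sum => i _.
rewrite normrM mxE.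
have -> : `|v 0 i| = (ComplexField.Normc.normc (v 0 i))%:C%C by [].
rewrite ger0_norm ?lecR // -!rmorphM lecR.
apply: (@le_trans _ _ (ComplexField.Normc.normc (v 0 j) * (A ^+ k) i j)).
  by apply: ler_wpM2r => //; exact: jmax.
by rewrite ler_wpM2l ?(ltW vj) // (bigD1 j) //= lerDl sumr_ge0.
Qed.

Lemma eigenvalue_le_spectral_radius z : eigenvalue Ac z -> ComplexField.Normc.normc z <= rho.
Proof.
move=> zA; apply: ub_le_sup; last by exists z.
(* [total 1] bounds the moduli of the eigenvalues, so their supremum is a genuine one. *)
by exists (total 1) => _ [y yA <-]; rewrite -[X in X <= _]expr1 eigenvalue_le_total.
Qed.

Hypothesis n_gt0 : (0 < n)%N.

Lemma eigenvalue_exists : exists z, eigenvalue Ac z.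
Proof.
exact: eigenvalue_closed.
Qed.

Lemma spectral_radius_ge0 : 0 <= rho.
Proof.
have [z zA] := eigenvalue_exists.
exact: le_trans (normc_ge0 z) (eigenvalue_le_spectral_radius zA).
Qed.

(** The bound on [|z|^k] becomes one on [|z|] by a [k]-th root before the supremum is taken; hence
    the separate case [k = 0]. *)
Lemma spectral_radius_exp_le k : rho ^+ k <= total k.
Proof.
have [->|k0] := posnP k.
  have [z zA] := eigenvalue_exists.
  by have := eigenvalue_le_total 0 zA; rewrite !expr0.
have t0 : 0 <= total k by rewrite sumr_ge0 // => i _; rewrite sumr_ge0.
have rle : rho <= total k `^ k%:R^-1.
  apply: ge_sup.
    by have [z zA] := eigenvalue_exists; exists (ComplexField.Normc.normc z), z.
  move=> _ [z zA <-]; have zk := eigenvalue_le_total k zA.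
  have z0 := normc_ge0 z.
  apply: le_trans (_ : (ComplexField.Normc.normc z ^+ k) `^ k%:R^-1 <= _).
    by rewrite -powR_mulrn // -powRrM divff ?powRr1 // pnatr_eq0 -lt0n.
  by rewrite ge0_ler_powR ?nnegrE ?invr_ge0 ?exprn_ge0.
apply: le_trans (_ : (total k `^ k%:R^-1) ^+ k <= _).
  by rewrite lerXn2r ?nnegrE ?spectral_radius_ge0 ?powR_ge0.
by rewrite -powR_mulrn ?powR_ge0 // -powRrM mulVf ?powRr1 // pnatr_eq0 -lt0n.
Qed.

Hypothesis A_prim : primitive_mx A.

(** With [c] the least entry of the positive matrix [A^d], each term [(A^k)_ij (A^d)_ji] of
    [tr (A^(k+d))] is at least [c (A^k)_ij]. *)
Lemma le_spectral_radius_exp : exists2 C, 0 < C & forall k, total k <= C * rho ^+ k.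
Proof.
have [d d0 Ad] := A_prim.
pose i0 := Ordinal n_gt0.
have [[i1 j1] _ /= minP] := @arg_minP _ _ _ (i0, i0) predT (fun ij => (A ^+ d) ij.1 ij.2) isT.
set c := (A ^+ d) i1 j1 in minP; have c0 : 0 < c by exact: Ad.
(* The [+ 1] makes the constant positive, as [rho] is only known to be nonnegative here. *)
exists (c^-1 * (n%:R * rho ^+ d) + 1) => [|k].
  by rewrite ltr_wpDl // !mulr_ge0 ?invr_ge0 ?(ltW c0) // exprn_ge0 ?spectral_radius_ge0.
have rk : 0 <= rho ^+ k by rewrite exprn_ge0 ?spectral_radius_ge0.
rewrite mulrDl mul1r ler_wpDr //.
rewrite -mulrA ler_pdivlMl //.
apply: (@le_trans _ _ (\tr (A ^+ (k + d)))).
  rewrite exprD /mxtrace /total mulr_sumr; apply: ler_sum => i _.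
  rewrite mxE mulr_sumr; apply: ler_sum => j _.
  by rewrite mulrC; apply: ler_wpM2l => //; exact: (minP (j, i) isT).
rewrite -lecR; apply: le_trans (_ : `|\tr (Ac ^+ (k + d))| <= _).
  rewrite map_mx_exp -trace_map_mx /= ger0_norm // ?lecR.
  by rewrite sumr_ge0 // => i _; rewrite mxE ler0c.
have /norm_trace_exp_le : forall z, eigenvalue Ac z -> `|z| <= rho%:C%C.
  by move=> z /eigenvalue_le_spectral_radius; rewrite -lecR.
move=> /(_ (k + d)%N)/le_trans; apply.
by rewrite -mulrA -exprD addnC !rmorphM rmorphXn /= rmorph_nat.
Qed.

End NonnegMatrix.

(** * Subadditive sequences *)

Section Growth.
Variable R : realType.

(** [f n / n] tends to [H] without falling below it; the error is split into a small slope [d] and a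
    constant. *)
Definition growth_rate (f : nat -> R) (H : R) :=
  (forall n, n%:R * H <= f n) /\
  forall d, 0 < d -> exists C, forall n, f n <= n%:R * (H + d) + C.

(** Fekete's lemma: [H] is the infimum of [f n / n], and division of [n] by a nearly optimal [a]
    gives the upper bound. *)
Lemma subadditive_growth_rate (f : nat -> R) :
  (forall n, 0 <= f n) -> (forall a b, f (a + b)%N <= f a + f b) ->
  exists H, growth_rate f H.
Proof.
move=> f0 fD; pose E := [set f n / n%:R | n in [set n | (0 < n)%N]].
have E0 : E !=set0 by exists (f 1%N / 1%:R), 1%N.
have Elb : has_lbound E.
  by exists 0 => _ [n n0 <-]; rewrite divr_ge0.
have fM n a : f (n * a)%N <= n%:R * f a + f 0.
  elim: n => [|n IHn]; first by rewrite mul0n mul0r add0r.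
  rewrite mulSn (le_trans (fD _ _)) // -natr1 mulrDl mul1r addrAC [leRHS]addrC.
  by rewrite lerD2l.
exists (inf E); split=> [n|d d0].
  have [->|n0] := posnP n; first by rewrite mul0r.
  rewrite -ler_pdivlMl ?ltr0n // mulrC; apply: ge_inf => //; first by exists n.
have [_ [a a0 <-] aE] := inf_adherent d0 (conj E0 Elb).
(* The constant absorbs the [f 0] of [fM] and the value at any remainder modulo [a]. *)
exists (f 0 + \sum_(i < a) f i) => n.
rewrite {1}(divn_eq n a) (le_trans (fD _ _)) // addrA lerD //; last first.
  have ra : (n %% a < a)%N by rewrite ltn_mod.
  by rewrite (bigD1 (Ordinal ra)) //= lerDl sumr_ge0.
apply: (le_trans (fM _ _)); rewrite lerD2r.
have Hd : 0 <= inf E + d by apply: le_trans (ltW aE); rewrite divr_ge0.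
apply: (@le_trans _ _ ((n %/ a)%:R * (a%:R * (inf E + d)))).
  by rewrite ler_wpM2l // -ler_pdivrMl ?ltr0n // mulrC ltW.
by rewrite mulrA -natrM ler_wpM2r // ler_nat leq_trunc_div.
Qed.

(** An arbitrary filter serves both limits: [n] to infinity for entropy, [e] to [0] for dimension.
    [a] may stay bounded, since [t] alone kills the constant. *)
Lemma growth_rate_cvg (U : Type) (F : set_system U) (FF : ProperFilter F)
    (f : nat -> R) (H c : R) (a : U -> nat) (t : U -> R) :
  growth_rate f H -> t u @[u --> F] --> +oo ->
  ((a u)%:R / t u) @[u --> F] --> c ->
  (f (a u) / t u) @[u --> F] --> c * H.
Proof.
move=> [fH fd] tF atF.
have tpos : \forall u \near F, 0 < t u by move/cvgryPgt : tF => /(_ 0).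
have itF : (t u)^-1 @[u --> F] --> (0 : R).
  exact/gtr0_cvgV0.
apply/cvgrPdist_le => e e0.
(* Once [a / t <= |c| + 1], this slope contributes at most [e / 3]. *)
have d0 : 0 < e / 3 / (`|c| + 1) by rewrite !divr_gt0 // ltr_wpDl.
have [C fC] := fd _ d0.
have aHF : ((a u)%:R / t u * H) @[u --> F] --> c * H by exact: cvgM atF (cvg_cst _).
have CF : (C * (t u)^-1) @[u --> F] --> (C * 0 : R) by exact: cvgM (cvg_cst _) itF.
near=> u.
have t0 : 0 < t u by near: u.
have h1 : `|c * H - (a u)%:R / t u * H| <= e / 3.
  near: u; move/cvgrPdist_le : aHF; apply; exact: divr_gt0.
have h2 : `|C * 0 - C * (t u)^-1| <= e / 3.
  near: u; move/cvgrPdist_le : CF; apply; exact: divr_gt0.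
have h3 : `|c - (a u)%:R / t u| <= 1.
  near: u; move/cvgrPdist_le : atF; apply; exact: ltr01.
have l1 : (a u)%:R / t u * H <= f (a u) / t u.
  by rewrite mulrAC ler_pM2r ?invr_gt0.
have l2 : f (a u) / t u <= (a u)%:R / t u * H +
    (a u)%:R / t u * (e / 3 / (`|c| + 1)) + C * (t u)^-1.
  rewrite -mulrDr mulrAC -mulrDl ler_pM2r ?invr_gt0 //; exact: fC.
have l3 : (a u)%:R / t u * (e / 3 / (`|c| + 1)) <= e / 3.
  rewrite mulrCA ger_pMr ?divr_gt0 // ler_pdivrMr ?mul1r ?ltr_wpDl //.
  have := ler_norm c; move: h3; rewrite ler_distlC; lra.
rewrite mulr0 sub0r normrN in h2; have := ler_norm (C * (t u)^-1).
move: h1; rewrite !ler_norml; lra.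
Unshelve. all: by end_near. Qed.

Lemma natmul_bounded (x C : R) : (forall n, n%:R * x <= C) -> x <= 0.
Proof.
move=> xC; rewrite leNgt; apply/negP => x0.
have := xC (Num.truncn (C / x)).+1; rewrite -ler_pdivlMr // leNgt.
by rewrite truncnS_gt.
Qed.

Lemma growth_rate_affine (f : nat -> R) (H rho c C : R) : growth_rate f H ->
  (forall n, c + n%:R * rho <= f n) -> (forall n, f n <= C + n%:R * rho) -> H = rho.
Proof.
move=> [fH fd] fc fC; apply/eqP; rewrite eq_le -subr_le0; apply/andP; split.
  by apply: (@natmul_bounded _ C) => n; have := fH n; have := fC n; lra.
apply/ler_addgt0Pr => d d0; have [D fD] := fd d d0.
rewrite -subr_le0; apply: (@natmul_bounded _ (D - c)) => n.
by have := fc n; have := fD n; lra.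
Qed.

End Growth.

(** * Approximate cubes and words *)

Lemma nvals_pair (X : Type) (T T' : finType) (K : set X) (F : X -> T)
    (F' : X -> T') :
  (nvals K (fun x => (F x, F' x)) <= nvals K F * nvals K F')%N.
Proof.
rewrite -cardX; apply: subset_leq_card; apply/fintype.subsetP => -[t t'] /asboolP[x Kx [<- <-]].
by apply/andP; split; apply/asboolP; exists x.
Qed.

Section Cubes.
Variables (m : nat -> nat) (r : nat).

Definition cube_type (L : nat -> nat) : finType :=
  {dffun forall j : 'I_r, {ffun 'I_(L j) -> 'I_(m j.+1)}}.

(** The digits kept name an approximate cube of the torus. [L] lives on all of [nat], so that it has
    a value at [r], beyond the last coordinate. *)
Definition cube (L : nat -> nat) (x : nat -> digits m r) : cube_type L :=
  finfun (fun j : 'I_r => [ffun k : 'I_(L j) => x k j]).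

Lemma cubeP L x y :
  cube L x = cube L y <-> forall (j : 'I_r) k, (k < L j)%N -> x k j = y k j.
Proof.
split=> [/ffunP xy j k kL|xy].
  by have := xy j; rewrite !ffunE => /ffunP/(_ (Ordinal kL)); rewrite !ffunE.
by apply/ffunP => j; rewrite !ffunE; apply/ffunP => k; rewrite !ffunE xy.
Qed.

(** A word of length [n] of [S^(i)] is a cube of depth [n] in the first [i] coordinates and [0] in
    the others, so one function counts words and cubes. *)
Definition word_lengths (i n j : nat) : nat := if (j < i)%N then n else 0%N.

Lemma word_cubeP i n x y :
  cube (word_lengths i n) x = cube (word_lengths i n) y <->
  forall (j : 'I_r) k, (j < i)%N -> (k < n)%N -> x k j = y k j.
Proof.
rewrite cubeP /word_lengths; split=> xy j k.
  by move=> ji kn; apply: xy; rewrite ji.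
by case: ifP => // ji; exact: xy.
Qed.

Variable G : labelled_graph (digits m r).
Let S : set (nat -> digits m r) := sofic_system G.

Definition ncubes (L : nat -> nat) : nat := nvals S (cube L).
Definition nwords (i n : nat) : nat := ncubes (word_lengths i n).

Definition shiftn (n : nat) (x : nat -> digits m r) : nat -> digits m r :=
  fun k => x (n + k)%N.

Lemma sofic_shiftn n x : S x -> S (shiftn n x).
Proof.
move=> [p pP ->]; exists (fun k => p (n + k)%N) => // k.
by rewrite addnS.
Qed.

Lemma nwordsD i a b : (nwords i (a + b) <= nwords i a * nwords i b)%N.
Proof.
pose c2 x := (cube (word_lengths i a) x, cube (word_lengths i b) (shiftn a x)).
have h1 : (nwords i (a + b) <= nvals S c2)%N.
  apply: (leq_nvals (g := id)) => // x y _ _ [/word_cubeP xya /word_cubeP xyb].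
  apply/word_cubeP => j k ji kab; have [ka|ak] := ltnP k a; first exact: xya.
  by have := xyb j (k - a)%N ji; rewrite /shiftn subnKC //; apply; rewrite ltn_subLR.
apply: (leq_trans h1); apply: (leq_trans (nvals_pair _ _ _)).
rewrite leq_mul2l; apply/orP; right; apply: (leq_nvals (g := shiftn a)) => // x.
exact: sofic_shiftn.
Qed.

Lemma nwords_mono i : {homo nwords i : a b / (a <= b)%N}.
Proof.
move=> a b ab; apply: (leq_nvals (g := id)) => // x y _ _ /word_cubeP xy.
by apply/word_cubeP => j k ji ka; apply: xy => //; exact: leq_trans ab.
Qed.

(** Pays back the symbols lost to a gap of length [k]; truncated subtraction covers [a < k] as
    well. *)
Lemma nwordsB i a k : (nwords i a <= nwords i (a - k) * nwords i k)%N.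
Proof. by apply: leq_trans (nwordsD _ _ _); apply: nwords_mono; lia. Qed.

(** * Decomposition of an approximate cube into words *)

Section Blocks.
Variable L : nat -> nat.
Hypotheses (Lmono : {homo L : i j / (i <= j)%N >-> (j <= i)%N}) (Lr : L r = 0%N).

(** At times [L j.+1 <= t < L j] exactly the coordinates [0, ..., j] are specified; this is block
    [j]. Its first [g] times are left free. *)
Let block_lengths g (j : 'I_r) := word_lengths j.+1 (L j - L j.+1 - g)%N.
Let block g (j : 'I_r) x := cube (block_lengths g j) (shiftn (L j.+1 + g) x).
Let blocks g x : {dffun forall j : 'I_r, cube_type (block_lengths g j)} :=
  finfun (block g ^~ x).

Lemma ncubes_le_prod :
  (ncubes L <= \prod_(j < r) nwords j.+1 (L j - L j.+1))%N.
Proof.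
apply: (@leq_trans (nvals S (blocks 0))).
  apply: (leq_nvals (g := id)) => // x y _ _ /ffunP xy; apply/cubeP => j t tj.
  (* The least such index is written [i.+1]; time [t] then falls in block [i], and [j <= i]. *)
  have exP : exists i, (j < i)%N && (L i <= t)%N by exists r; rewrite ltn_ord Lr.
  case: (ex_minnP exP) => -[//|i] /andP[ji Lit] imin.
  have ir : (i < r)%N by apply: imin; rewrite ltn_ord Lr.
  have tLi : (t < L i)%N.
    rewrite ltnNge; apply/negP => Lit'; have [ij|ij] := ltnP j i.
      by have := imin i; rewrite ij Lit' ltnn => /(_ isT).
    move: tj; rewrite (_ : j = i :> nat) ?ltnNge ?Lit' //.
    by apply/eqP; rewrite eqn_leq ij andbT -ltnS.
  have := xy (Ordinal ir); rewrite !ffunE => /word_cubeP/(_ j (t - L i.+1)%N ji).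
  by rewrite /shiftn /= addn0 subnKC //; apply; lia.
apply: (leq_trans (nvals_le_prod _ _)); apply: leq_prod => j _.
rewrite -[X in nwords _ X]subn0.
apply: (leq_nvals (g := shiftn (L j.+1 + 0))) => // x; exact: sofic_shiftn.
Qed.

Lemma prod_le_ncubes k : (0 < r)%N -> prepends G k ->
  (\prod_(j < r) nwords j.+1 (L j - L j.+1 - k) <= ncubes L)%N.
Proof.
move=> r_gt0 kG.
apply: (@leq_trans (nvals S (blocks k))); last first.
  apply: (leq_nvals (g := id)) => // x y _ _ /cubeP xy; apply/ffunP => j.
  rewrite !ffunE; apply/word_cubeP => i t ij tk; apply: xy.
  by apply: leq_trans (Lmono (_ : (i <= j)%N)); lia.
apply: (prod_nvals_le (K' := fun=> S)) => q Sq.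
have /choice[pq pqP] : forall j, exists p : nat -> edge G,
    is_path p /\ q j = (fun k => label (p k)).
  by move=> j; have [p pP qp] := Sq j; exists p.
pose j0 := Ordinal r_gt0.
(* In order of time the blocks come with decreasing [j]: number [b] is [j = r - b.+1] and begins at
   [L (r - b)]. [j0] is the default of [insubd]. *)
pose q' b := pq (insubd j0 (r - b.+1)%N).
have [p' p'P p'q] := @glue_blocks _ G k (fun b => L (r - b)%N) (pq j0) q' r kG
  (fun i j ij => Lmono (leq_sub2l r ij)) (proj1 (pqP _)) (fun b => proj1 (pqP _)).
exists (fun k => label (p' k)); first by exists p'.
move=> j; apply/word_cubeP => i t ij tj.
have := p'q (r - j.+1)%N t; have jr := ltn_ord j.
have -> : (r - (r - j.+1) = j.+1)%N by lia.
have -> : (r - (r - j.+1).+1 = j)%N by lia.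
have rr : (r - (r - j.+1).+1 = j)%N by lia.
rewrite /shiftn /q' rr valKd => -> //; last 2 first.
- by lia.
- by lia.
by case: (pqP j) => _ ->.
Qed.
End Blocks.
End Cubes.

(** * Covering numbers and compactness *)

Section CoverNumber.
Variables (R : realType) (X : Type) (T : finType) (K : set X) (F : X -> T).
Variable W : set (set X).

Lemma cover_number_le_nvals :
  (forall x, K x -> exists2 V, W V & forall y, K y -> F y = F x -> V y) ->
  (cover_number R K W <= (nvals K F)%:R%:E)%E.
Proof.
move=> KW; apply: ereal_inf_lbound; exists (nvals K F) => //=.
set A := [pred t | `[< exists2 x, K x & F x = t >]].
have /choice[V VP] : forall t, exists V, t \in A ->
    W V /\ forall y, K y -> F y = t -> V y.
  move=> t; have [/asboolP[x Kx <-]|_] := boolP (t \in A); last by exists setT.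
  by have [V WV VP] := KW x Kx; exists V.
exists (fun i : 'I_(#|A|) => V (enum_val i)) => [i|x Kx].
  by have [] := VP _ (enum_valP i).
have Ax : F x \in A by apply/asboolP; exists x.
exists (enum_rank_in Ax (F x)) => //; rewrite enum_rankK_in //.
by have [_] := VP _ Ax; apply.
Qed.

(** Within one member of [W] the value of [F] is pinned down by [g], so a member accounts for at
    most [#|T'|] values. *)
Lemma nvals_le_cover_number (T' : finType) :
  (forall V, W V -> exists g : X -> T', forall x y, K x -> K y -> V x -> V y ->
     g x = g y -> F x = F y) ->
  (((nvals K F)%:R / #|T'|%:R)%:E <= cover_number R K W)%E.
Proof.
move=> Wg; apply: le_ereal_inf_tmp => _ [N [V WV KV] <-].
rewrite lee_fin; have [T0|T0] := posnP #|T'|.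
  (* The inverse of [0] is [0], so the bound is trivial for empty [T']. *)
  by rewrite T0 invr0 mulr0.
rewrite ler_pdivrMr ?ltr0n // -natrM ler_nat.
have /choice[g gP] : forall i, exists g : X -> T', forall x y, K x -> K y ->
    V i x -> V i y -> g x = g y -> F x = F y by move=> i; exact: Wg.
have [K0|/set0P[x0 Kx0]] := eqVneq K set0.
  rewrite /nvals eq_card0 // => t; apply/negP => /asboolP[x].
  by rewrite K0.
have [i0 _ _] := KV _ Kx0.
have /choice[idx idxP] : forall x, exists i, K x -> V i x.
  move=> x; case: (pselect (K x)) => [/KV[i _ Vx]|nKx]; first by exists i.
  by exists i0.
apply: (@leq_trans (nvals K (fun x => (idx x, g (idx x) x)))).
  apply: (leq_nvals (g := id)) => // x y Kx Ky [ixy].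
  by rewrite -ixy; apply: (gP (idx x)) => //; [exact: idxP|rewrite ixy; exact: idxP].
apply: leq_trans (max_card _) _; by rewrite card_prod card_ord.
Qed.

End CoverNumber.

Lemma limn_esup_le (R : realType) (u : (\bar R)^nat) (v : R^nat) (l : R) :
  (forall n, (0 < n)%N -> (u n <= (v n)%:E)%E) -> v @ \oo --> l ->
  (limn_esup u <= l%:E)%E.
Proof.
move=> uv vl; apply/lee_addgt0Pr => e e0.
have /cvgrPdist_le/(_ _ e0)[n _ nP] := vl.
have h0 : (limn_esup u <= ereal_sup (u @` [set k | (n.+1 <= k)%N]))%E.
  by apply: ereal_inf_lbound; exists [set k | (n.+1 <= k)%N] => //; exists n.+1.
apply: (le_trans h0); apply: ge_ereal_sup => _ [k /= nk <-].
have h : (u k <= (v k)%:E)%E by apply: uv; exact: leq_trans nk.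
apply: (le_trans h); rewrite -EFinD lee_fin.
by have := nP k (ltnW nk); rewrite /= ler_norml; lra.
Qed.

Lemma limn_esup_ge (R : realType) (u : (\bar R)^nat) (l : \bar R) :
  (forall n, (0 < n)%N -> (l <= u n)%E) -> (l <= limn_esup u)%E.
Proof.
move=> lu; apply: le_ereal_inf_tmp => _ [A [n _ nA] <-].
apply: (le_trans (lu n.+1 isT)); apply: ereal_sup_ubound; exists n.+1 => //.
by apply: nA => /=.
Qed.

Lemma le_lne_EFin (R : realType) (x : \bar R) (a : R) :
  0 < a -> (a%:E <= x)%E -> ((ln a)%:E <= lne x)%E.
Proof.
move=> a0 ax; have x0 : (0 <= x)%E by apply: le_trans ax; rewrite lee_fin ltW.
by rewrite -lne_EFin // lee_lne // in_itv /= leey andbT // lee_fin ltW.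
Qed.

Lemma lne_le_EFin (R : realType) (x : \bar R) (a : R) :
  (0 <= x)%E -> 0 < a -> (x <= a%:E)%E -> (lne x <= (ln a)%:E)%E.
Proof.
move=> x0 a0 ax.
by rewrite -lne_EFin // lee_lne // in_itv /= leey andbT // lee_fin ltW.
Qed.

Lemma cover_number_ge0 (R : realType) (X : Type) (K : set X) W :
  (0 <= cover_number R K W)%E.
Proof. by apply: le_ereal_inf_tmp => _ [N _ <-]; rewrite lee_fin. Qed.

Lemma nbhs_cylinder (T : choiceType) (x : {ptws nat -> discrete_topology T}) n :
  nbhs x [set y : {ptws nat -> discrete_topology T} | forall k, (k < n)%N -> y k = x k].
Proof.
elim: n => [|n IHn]; first by apply: filterS filterT.
have := @proj_continuous nat (fun=> discrete_topology T) n x [set x n] (discrete_set1 _).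
move=> /(filterI IHn); apply: filterS => y /= [yx yn] k.
by rewrite ltnS leq_eqVlt => /predU1P[->|/yx].
Qed.

(** Otherwise points outside [O] that share longer and longer prefixes with [x] converge to [x],
    although [O] is a neighbourhood of [x]. *)
Lemma open_cylinder (T : choiceType) (O : set {ptws nat -> discrete_topology T}) x :
  open O -> O x -> exists n, forall y : {ptws nat -> discrete_topology T},
    (forall k, (k < n)%N -> y k = x k) -> O y.
Proof.
move=> oO Ox; apply: contrapT => /forallNP nO.
have /choice[g gP] : forall n, exists y : {ptws nat -> discrete_topology T},
    (forall k, (k < n)%N -> y k = x k) /\ ~ O y.
  by move=> n; have /existsNP[y /not_implyP[yx nOy]] := nO n; exists y.
have gx : g @ \oo --> x.
  apply/cvg_sup => N U [V] [[W] oW <-] WfN WU.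
  apply: (filterS WU); exists N.+1 => // i /= Ni.
  by rewrite /= (proj1 (gP i)).
have : nbhs x O by exact: open_nbhs_nbhs.
by move=> /gx[n _ /(_ n (leqnn n))]; exact: (proj2 (gP n)).
Qed.

Section PathCompactness.
Variables (L : Type) (G : labelled_graph L).

(** Koenig's lemma through Tychonoff: [q] is a cluster point of the [p i] in a product of finite
    spaces. *)
Lemma path_cluster (p : nat -> nat -> edge G) : (forall i, is_path (p i)) ->
  exists q, is_path q /\
    forall n, exists2 i, (n <= i)%N & forall k, (k < n)%N -> p i k = q k.
Proof.
move=> pP.
have := @tychonoff nat (fun=> discrete_topology (edge G)) (fun=> setT)
  (fun=> @finite_compact (discrete_topology (edge G)) setT (@finite_finset (edge G) setT)).
move=> /(_ ((p : nat -> {ptws nat -> discrete_topology (edge G)}) @ \oo)).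
case=> [|q [_ qcl]]; first by apply: filterS filterT.
have agree n : exists2 i, (n <= i)%N & forall k, (k < n)%N -> p i k = q k.
  have [|y [[i ni <-] qi]] := qcl [set p i | i in [set i | (n <= i)%N]] _ _ (nbhs_cylinder q n).
    by exists n => // i /= ni; exists i.
  by exists i.
exists q; split=> // k.
by have [i _ iq] := agree k.+2; rewrite -!iq //; exact: pP.
Qed.

End PathCompactness.

(** * Topological entropy *)

Lemma cvg_addn_ratio (R : realType) d :
  ((n + d)%:R / n%:R : R) @[n --> \oo] --> (1 : R).
Proof.
have n0 : \forall n \near \oo, 0 < n%:R :> R.
  by exists 1%N => // n /= n1; rewrite ltr0n.
have ninv : (n%:R^-1 : R) @[n --> \oo] --> (0 : R).
  by apply/(gtr0_cvgV0 n0); exact: cvgr_idn.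
have : (1 + d%:R * n%:R^-1 : R) @[n --> \oo] --> (1 + d%:R * 0 : R).
  exact: cvgD (cvg_cst _) (cvgM (cvg_cst _) ninv).
rewrite mulr0 addr0; apply: cvg_trans; apply: near_eq_cvg.
near=> n; have n1 : (n%:R : R) != 0 by rewrite gt_eqF //; near: n.
by rewrite natrD mulrDl divff.
Unshelve. all: by end_near. Qed.

Section Entropy.
Variables (R : realType) (m : nat -> nat) (r : nat).
Variables (G : labelled_graph (digits m r)) (i : nat) (le_ir : (i <= r)%N).
Let S : set (digit_seq m r) := sofic_system G.
Let K : set (digit_seq m i) := trunc_seq le_ir @` S.

Let prefix n (y : digit_seq m i) : {ffun 'I_n -> digits m i} := prefix_of n y.

Lemma nvals_trunc n : nvals K (prefix n) = nwords G i n.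
Proof.
have prefixE x y : prefix n (trunc_seq le_ir x) = prefix n (trunc_seq le_ir y) <->
    cube (word_lengths i n) x = cube (word_lengths i n) y.
  rewrite word_cubeP; split=> [/prefix_ofP xy j k ji kn|xy].
    have := xy k kn => /ffunP/(_ (Ordinal ji)); rewrite !ffunE.
    (* The type of a digit depends on its coordinate, so the equality is transported along
       [j' = j]. *)
    have xyj j' : j' = j -> x k j' = y k j' -> x k j = y k j by move=> ->.
    by apply: (xyj (widen_ord le_ir (Ordinal ji))); exact: val_inj.
  by apply/prefix_ofP => k kn; apply/ffunP => j; rewrite !ffunE xy //=.
rewrite nvals_image; apply/eqP; rewrite eqn_leq; apply/andP.
by split; apply: (leq_nvals (g := id)) => // x y _ _ /prefixE.
Qed.

Lemma iter_shift k (x : digit_seq m i) : iter k (@shift m i) x = (fun j => x (k + j)%N).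
Proof.
elim: k => [//|k IHk]; rewrite iterS IHk; apply/funext => j /=.
by rewrite /shift addnS.
Qed.

Lemma trunc_iter_shift k y : K y -> K (iter k (@shift m i) y).
Proof.
move=> [x Sx <-]; exists (iter k (@shift m r) x).
  elim: k => [//|k]; rewrite iterS => -[p pP ->].
  by exists (fun j => p j.+1).
by elim: k => [//|k IH]; rewrite !iterS -IH.
Qed.

(** A Lebesgue number of the cover. Compactness is used on paths: a cluster path of counterexamples
    has its truncated labels in some [O], which contains a whole cylinder. *)
Lemma open_cover_lebesgue U : open_cover K U ->
  exists n, forall x, K x -> exists2 O, U O &
    forall y, (forall k, (k < n)%N -> y k = x k) -> O y.
Proof.
move=> [oU KU]; apply: contrapT => /forallNP nU.
have /choice[p pP] : forall n, exists p : nat -> edge G, is_path p /\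
    forall O, U O -> ~ (forall y : digit_seq m i,
      (forall k, (k < n)%N -> y k = trunc_digits le_ir (label (p k))) -> O y).
  move=> n; have /existsNP[x /not_implyP[[_ [p pp ->] <-] nx]] := nU n.
  by exists p; split=> // O UO yO; apply: nx; exists O.
have [q [qP pq]] := path_cluster (fun n => proj1 (pP n)).
have [|O UO Oq] := KU (fun k => trunc_digits le_ir (label (q k))).
  by exists (fun k => label (q k)) => //; exists q.
have [n nO] := open_cylinder (oU _ UO) Oq.
have [j nj jq] := pq n; apply: (proj2 (pP j) _ UO) => y yp.
by apply: nO => k kn; rewrite yp ?jq //; exact: leq_trans nj.
Qed.

Hypothesis S_neq0 : S !=set0.
Variable H : R.
Hypothesis growthH : growth_rate (fun n => ln (nwords G i n)%:R) H.

Let nw_gt0 n : 0 < (nwords G i n)%:R :> R.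
Proof. by rewrite ltr0n nvals_gt0. Qed.

(** If [d] symbols decide a member of [U], then [n + d] symbols decide a member of the [n]-fold
    join; the extra [d] disappears in the limit. *)
Lemma cover_entropy_le U : open_cover K U ->
  (cover_entropy R (@shift m i) K U <= H%:E)%E.
Proof.
move=> /open_cover_lebesgue[d dP].
apply: (limn_esup_le (v := fun n => ln (nwords G i (n + d))%:R / n%:R)); last first.
  rewrite -[X in _ --> X]mul1r.
  apply: (@growth_rate_cvg _ _ (nbhs \oo) _ _ _ _ (fun n => (n + d)%N) (fun n => n%:R) growthH).
    exact: cvgr_idn.
  exact: cvg_addn_ratio.
move=> n n0; rewrite [X in (_ <= X%:E)%E]mulrC EFinM.
rewrite lee_pmul2l ?lte_fin ?invr_gt0 ?ltr0n //; apply: lne_le_EFin => //.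
  exact: cover_number_ge0.
rewrite -nvals_trunc; apply: cover_number_le_nvals => x Kx.
have /choice[V VP] : forall k, exists V, U V /\
    forall y : digit_seq m i, (forall t, (t < d)%N -> y t = x (k + t)%N) -> V y.
  move=> k; have := trunc_iter_shift k Kx => /dP[V UV]; rewrite iter_shift => Vy.
  by exists V.
exists (\bigcap_(k in `I_n) (iter k (@shift m i) @^-1` V k)).
  by exists V => // k _; case: (VP k).
move=> y Ky /prefix_ofP yx k kn; rewrite /preimage /= iter_shift.
by apply: (proj2 (VP k)) => t td; apply: yx; rewrite /= in kn; lia.
Qed.

(** Two points in one member of the join of this cover share their first [n] symbols, so the lower
    bound holds with factor [1]. *)
Lemma cover_entropy_symbols_ge :
  let U := [set [set y : digit_seq m i | y 0%N = a] | a in [set: digits m i]] in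
  open_cover K U /\ (H%:E <= cover_entropy R (@shift m i) K U)%E.
Proof.
move=> U; split; first split.
- move=> _ [a _ <-].
  rewrite openE => y ya; apply: filterS (nbhs_cylinder y 1) => z zy.
  by rewrite /= zy.
- by move=> y _; exists [set z | z 0%N = y 0%N] => //; exists (y 0%N).
apply: limn_esup_ge => n n0.
apply: (@le_trans _ _ ((n%:R^-1)%:E * (ln (nwords G i n)%:R)%:E)%E).
  rewrite -EFinM lee_fin ler_pdivlMl ?ltr0n //; exact: growthH.1.
rewrite lee_pmul2l ?lte_fin ?invr_gt0 ?ltr0n //.
apply: le_lne_EFin => //.
have -> : (nwords G i n)%:R = (nwords G i n)%:R / #|{: unit}|%:R :> R.
  by rewrite card_unit divr1.
rewrite -nvals_trunc; apply: nvals_le_cover_number => _ [w wU <-].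
exists (fun=> tt) => x y _ _ xw yw _; apply/prefix_ofP => k kn.
have [a _ wk] := wU k kn; have := xw k kn; have := yw k kn.
by rewrite /preimage /= !iter_shift -wk /= addn0 => -> ->.
Qed.

Lemma top_entropy_trunc : top_entropy R (@shift m i) K = H%:E.
Proof.
apply/eqP; rewrite eq_le; apply/andP; split.
  by apply: ge_ereal_sup => _ [U UK <-]; exact: cover_entropy_le.
have [UK UH] := cover_entropy_symbols_ge.
by apply: (le_trans UH); apply: ereal_sup_ubound; eexists; [exact: UK|].
Qed.

End Entropy.

Lemma trunc_seq_id (m : nat -> nat) (r : nat) (le_rr : (r <= r)%N) (x : digit_seq m r) :
  trunc_seq le_rr x = x.
Proof.
apply/funext => k; apply/ffunP => j; rewrite ffunE.
have xj j' : j' = j -> val (x k j') = val (x k j) by move=> ->.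
by apply/val_inj/xj/val_inj.
Qed.

(** * Approximate cubes and balls of the torus *)

(** Moves covers by balls of the torus to sequence space, where the bounds by [nvals] apply. *)
Lemma cover_number_image (R : realType) (X Y : Type) (g : X -> Y) (K : set X)
    (W : set (set Y)) :
  cover_number R (g @` K) W = cover_number R K [set g @^-1` V | V in W].
Proof.
rewrite /cover_number; congr (ereal_inf (_ @` _)); apply/seteqP; split=> N /= [F WF KF].
  exists (fun i => g @^-1` F i) => [i|x Kx]; first by exists (F i).
  by have [|i _ Fx] := KF (g x); [exists x|exists i].
have /choice[V VP] : forall i, exists V, W V /\ g @^-1` V = F i.
  by move=> i; have [V WV VF] := WF i; exists V.
exists V => [i|_ [x Kx <-]]; first by case: (VP i).
by have [i _ Fx] := KF x Kx; exists i => //; move: Fx; case: (VP i) => _ <-.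
Qed.

(** * Expansions in base [b] *)

Section Expansion.
Variables (R : realType) (b : nat) (d : nat -> nat).
Hypothesis db : forall k, (d k < b)%N.

Fixpoint expansion_code (c : nat -> nat) (n : nat) : nat :=
  if n is n'.+1 then (expansion_code c n' * b + c n')%N else 0%N.

Lemma expansion_code_lt n : (expansion_code d n < b ^ n)%N.
Proof.
elim: n => [//|n IHn]; rewrite expnSr /=.
apply: (@leq_trans ((expansion_code d n).+1 * b)); last by rewrite leq_mul2r IHn orbT.
by rewrite mulSn; have := db n; lia.
Qed.

Let b_gt0 : 0 < b%:R :> R.
Proof. by rewrite ltr0n (leq_ltn_trans _ (db 0)). Qed.

Let u k : R := (d k)%:R / b%:R ^+ k.+1.

Lemma series_expansion n : series u n = (expansion_code d n)%:R / b%:R ^+ n.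
Proof.
elim: n => [|n IHn]; first by rewrite /series /= big_geq // mul0r.
rewrite seriesSr IHn /u /= natrD natrM mulrDl; congr (_ + _).
by rewrite exprSr invfM mulrACA divff ?mulr1 // gt_eqF.
Qed.

(** These are the right endpoints of the nested [b]-adic intervals of the expansion. *)
Lemma expansion_upper_noninc : nonincreasing_seq (fun n : nat =>
  (expansion_code d n).+1%:R / b%:R ^+ n : R).
Proof.
apply/nonincreasing_seqP => n.
rewrite ler_pdivrMr ?exprn_gt0 // exprSr mulrA divfK ?gt_eqF ?exprn_gt0 //.
by rewrite -natrM ler_nat mulSn /=; have := db n; lia.
Qed.

(** Both ends are included: tails of digits [0], or of [b - 1] when [b >= 2], attain them. *)
Lemma expansion_bounds n :
  (expansion_code d n)%:R / b%:R ^+ n <= limn (series u) <=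
  (expansion_code d n).+1%:R / b%:R ^+ n.
Proof.
have nd : nondecreasing_seq (series u).
  by apply: nondecreasing_series => k _ _; rewrite divr_ge0 ?exprn_ge0 // ltW.
have ub k : (n <= k)%N -> series u k <= (expansion_code d n).+1%:R / b%:R ^+ n.
  move=> nk; apply: le_trans (expansion_upper_noninc nk).
  by rewrite series_expansion ler_pM2r ?invr_gt0 ?exprn_gt0 // ler_nat.
have cu : cvgn (series u).
  apply: nondecreasing_is_cvgn => //.
  exists ((expansion_code d n).+1%:R / b%:R ^+ n) => _ [k _ <-].
  have [kn|nk] := leqP k n; last exact/ub/ltnW.
  by apply: le_trans (ub n (leqnn n)); exact: nd.
apply/andP; split.
  rewrite -series_expansion; apply: limr_ge => //.
  by exists n => // k /= nk; exact: nd.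
by apply: limr_le => //; exists n => // k /= nk; exact: ub.
Qed.

End Expansion.

Lemma expansion_code_inj b (c d : nat -> nat) n :
  (forall k, c k < b)%N -> (forall k, d k < b)%N ->
  expansion_code b c n = expansion_code b d n -> forall k, (k < n)%N -> c k = d k.
Proof.
move=> cb db; elim: n => [//|n IHn] /= cd k.
have cdn : c n = d n.
  by have := congr1 (modn ^~ b) cd; rewrite /= !modnMDl !modn_small.
have /IHn{}IHn : expansion_code b c n = expansion_code b d n.
  move: cd; rewrite cdn => /addIn/eqP; rewrite eqn_pmul2r => [/eqP //|].
  exact: leq_ltn_trans (cb 0).
by rewrite ltnS leq_eqVlt => /predU1P[->|/IHn].
Qed.

Section TorusDistance.
Variables (R : realType) (r : nat).
Local Open Scope quotient_scope.

Lemma torus_projP (x y : 'rV[R]_r) :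
  torus_proj x = torus_proj y <-> forall j, exists N : int, x 0 j - y 0 j = N%:~R.
Proof.
split=> [/eqmodP/forallP xy j|xy]; first by have /intrP[N ->] := xy j; exists N.
apply/eqmodP/forallP => j; have [N ->] := xy j; exact: intr_int.
Qed.

Lemma torus_projK (p : torus R r) : exists x, torus_proj x = p.
Proof. by exists (repr p); rewrite /torus_proj reprK. Qed.

Lemma flat_dist_le (x y : 'rV[R]_r) :
  flat_dist (torus_proj x) (torus_proj y) <= euclidean_dist x y.
Proof.
apply: ge_inf; last by exists (x, y).
by exists 0 => _ [z _ <-]; exact: sqrtr_ge0.
Qed.

(** The strict inequality avoids having to show that the infimum is attained. *)
Lemma flat_dist_lt (p q : torus R r) (e : R) : flat_dist p q < e ->
  exists x y, [/\ torus_proj x = p, torus_proj y = q & euclidean_dist x y < e].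
Proof.
have [x0 x0p] := torus_projK p; have [y0 y0q] := torus_projK q.
move=> /inf_lt[|_ [[x y] /= [xp yq] <-] xye]; last by exists x, y.
by exists (euclidean_dist x0 y0), (x0, y0).
Qed.

Lemma coord_le_euclidean_dist (x y : 'rV[R]_r) j :
  `|x 0 j - y 0 j| <= euclidean_dist x y.
Proof.
rewrite -sqrtr_sqr ler_wsqrtr // (bigD1 j) //= lerDl.
by apply: sumr_ge0 => i _; exact: sqr_ge0.
Qed.

Lemma euclidean_dist_le (x y : 'rV[R]_r) (e : R) : 0 <= e ->
  (forall j, `|x 0 j - y 0 j| <= e) -> euclidean_dist x y <= r%:R * e.
Proof.
move=> e0 xye; rewrite -[leRHS]ger0_norm ?mulr_ge0 // -sqrtr_sqr ler_wsqrtr //.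
apply: (@le_trans _ _ (\sum_(j < r) e ^+ 2)).
  by apply: ler_sum => j _; rewrite -real_normK ?num_real // lerXn2r ?nnegrE.
rewrite sumr_const card_ord -(mulr_natl (e ^+ 2)) exprMn ler_wpM2r ?sqr_ge0 //.
by rewrite -natrX ler_nat; case: (r) => // n; rewrite expnS leq_pmulr.
Qed.

End TorusDistance.

(** * Comparison of ball covers with approximate cubes *)

Section TorusCover.
Variables (R : realType) (m : nat -> nat) (r : nat).
Variable G : labelled_graph (digits m r).
Let S : set (digit_seq m r) := sofic_system G.
Let X := @digit_map R r m @` S.

Definition coord (x : digit_seq m r) (j : 'I_r) : R :=
  limn (series (fun k => ((x k : digits m r) j)%:R / (m j.+1)%:R ^+ k.+1 : R)).

Definition coord_code (L : nat -> nat) (x : digit_seq m r) (j : 'I_r) : nat :=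
  expansion_code (m j.+1) (fun k => (x k : digits m r) j) (L j).

Lemma digit_mapE x : digit_map R x = torus_proj (\row_j coord x j).
Proof. by []. Qed.

Lemma coord_bounds (L : nat -> nat) x j :
  (coord_code L x j)%:R <= coord x j * (m j.+1)%:R ^+ L j <= (coord_code L x j)%:R + 1.
Proof.
have := @expansion_bounds R (m j.+1) (fun k => (x k : digits m r) j) (fun k => ltn_ord _) (L j).
have m0 : 0 < (m j.+1)%:R ^+ L j :> R.
  by rewrite exprn_gt0 // ltr0n (leq_ltn_trans _ (ltn_ord ((x 0%N : digits m r) j))).
by rewrite ler_pdivrMr // ler_pdivlMr // -natr1.
Qed.

Lemma cube_codeP (L : nat -> nat) x y :
  cube L x = cube L y <-> forall j, coord_code L x j = coord_code L y j.
Proof.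
rewrite cubeP; split=> xy j.
  rewrite /coord_code; have := xy j; move: (L j) => n; elim: n => [//|n IHn] xyn /=.
  by rewrite IHn ?xyn // => k kn; rewrite xyn // ltnW.
move=> k kL; apply: val_inj.
exact: (expansion_code_inj (fun=> ltn_ord _) (fun=> ltn_ord _) (xy j)).
Qed.

(** Points of one cube differ by at most [m_j^(-L j) <= e / r] in each coordinate, so the ball about
    any of them contains all. *)
Lemma cover_number_le_ncubes (L : nat -> nat) (e : R) :
  (forall j : 'I_r, r%:R <= e * (m j.+1)%:R ^+ L j) -> 0 <= e ->
  (cover_number R X (closed_balls (@flat_dist R r) e) <= (ncubes G L)%:R%:E)%E.
Proof.
move=> eL e0; rewrite cover_number_image; apply: cover_number_le_nvals => x Sx.
eexists; first by exists [set q | flat_dist (digit_map R x) q <= e] => //; exists (digit_map R x).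
move=> y Sy /cube_codeP yx; rewrite /preimage /= !digit_mapE.
apply: (le_trans (flat_dist_le _ _)).
have [r0|r0] := posnP r.
  rewrite /euclidean_dist big1 ?sqrtr0 // => j.
  by exfalso; have := leq_ltn_trans (leq0n j) (ltn_ord j); rewrite r0.
have -> : e = r%:R * (e / r%:R) by rewrite mulrCA divff ?mulr1 // pnatr_eq0 -lt0n.
apply: euclidean_dist_le => [|j]; first by rewrite divr_ge0.
have m0 : 0 < (m j.+1)%:R ^+ L j :> R.
  by rewrite exprn_gt0 // ltr0n (leq_ltn_trans _ (ltn_ord ((x 0%N : digits m r) j))).
rewrite !mxE ler_pdivlMr ?ltr0n // -(ler_pM2r m0); apply: (@le_trans _ _ r%:R); last exact: eL.
rewrite mulrAC ger_pMl ?ltr0n // -[X in _ * X](gtr0_norm m0) -normrM mulrBl.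
have := coord_bounds L x j; have := coord_bounds L y j; rewrite yx ler_norml; lra.
Qed.

(* Modulo m_j^(L j), the codes in coordinate j of the points of a ball of radius
   e lie within E + 2 of the integer part of m_j^(L j) times the j-th coordinate
   of its centre: E for the radius, 1 for the remaining digits and 1 for the
   integer part. *)
Lemma ncubes_le_cover_number (L : nat -> nat) (e : R) (E : nat) : 0 < e ->
  (forall j : 'I_r, 2 * e * (m j.+1)%:R ^+ L j <= E%:R) ->
  (((ncubes G L)%:R / ((E + E + 4).+1 ^ r)%:R)%:E <=
    cover_number R X (closed_balls (@flat_dist R r) e))%E.
Proof.
move=> e0 eE; rewrite cover_number_image.
have -> : ((E + E + 4).+1 ^ r = #|{ffun 'I_r -> 'I_((E + E + 4).+1)}|)%N.
  by rewrite card_ffun !card_ord.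
apply: nvals_le_cover_number => _ [_ [p _ <-] <-].
have [c cp] := torus_projK p.
pose f j : int := Num.floor (c 0 j * (m j.+1)%:R ^+ L j).
(* [t j] is the difference of [f j] and the code modulo [m_j^(L j)], shifted by [E + 2] to lie
   between [0] and [E + E + 4]. *)
have ex x : exists t : {ffun 'I_r -> 'I_((E + E + 4).+1)}, flat_dist p (digit_map R x) <= e ->
    forall j, exists N : int,
      f j - (coord_code L x j)%:Z = N * (m j.+1 ^ L j)%:Z + (t j)%:Z - (E + 2)%:Z.
  case: (pselect (flat_dist p (digit_map R x) <= e)); last first.
    by move=> npe; exists [ffun=> ord0] => pe.
  (* Representatives are available only below a strict bound, whence [2 * e] in place of [e]. *)
  move=> pe; have /flat_dist_lt[y [z [yp zx yz]]] : flat_dist p (digit_map R x) < 2 * e.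
    by apply: (le_lt_trans pe); lra.
  have /choice[N NP] : forall j, exists N : int, `|c 0 j - coord x j - N%:~R| <= 2 * e.
    move=> j; move: yp; rewrite -cp => /torus_projP/(_ j)[N1 yc].
    move: zx; rewrite digit_mapE => /torus_projP/(_ j)[N2]; rewrite mxE => zx.
    exists (N2 - N1); have := coord_le_euclidean_dist y z j; rewrite rmorphB /= -zx -yc.
    move=> yzj; apply: le_trans (ltW yz); apply: le_trans yzj.
    by rewrite le_eqVlt; apply/orP; left; apply/eqP; congr (`|_|); ring.
  have NE j : `|f j - (coord_code L x j)%:Z - N j * (m j.+1 ^ L j)%:Z| <= (E + 2)%:Z.
    have B0 : 0 < (m j.+1)%:R ^+ L j :> R.
      by rewrite exprn_gt0 // ltr0n (leq_ltn_trans _ (ltn_ord ((x 0%N : digits m r) j))).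
    have := NP j; rewrite -(ler_pM2r B0) -[X in _ * X <= _](gtr0_norm B0) -normrM !mulrBl => h1.
    have := le_trans h1 (eE j); have := coord_bounds L x j.
    have := floor_itv (c 0 j * (m j.+1)%:R ^+ L j); rewrite -/(f j).
    rewrite -(ler_int R) intr_norm !rmorphB !rmorphM rmorphD /= -!pmulrn natrD natrX.
    rewrite !ler_norml.
    set u1 := c 0 j * _; set u2 := coord x j * _; set u3 := (N j)%:~R * _.
    move: u1 u2 u3 => u1 u2 u3; lra.
  exists [ffun j =>
    inord (absz (f j - (coord_code L x j)%:Z - N j * (m j.+1 ^ L j)%:Z + (E + 2)%:Z))].
  move=> _ j; exists (N j); rewrite ffunE; have := NE j.
  by move: (N j * _) => NB Nj; rewrite inordK; lia.
have /choice[g gP] := ex.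
exists g => x y Sx Sy px py gxy; apply/cube_codeP => j.
have [N1 h1] := gP x px j; have [N2 h2] := gP y py j.
rewrite -gxy in h2.
have := expansion_code_lt (fun k => ltn_ord ((x k : digits m r) j)) (L j).
have := expansion_code_lt (fun k => ltn_ord ((y k : digits m r) j)) (L j).
rewrite -/(coord_code L x j) -/(coord_code L y j).
move: h1 h2; move: (coord_code L x j) (coord_code L y j) (m j.+1 ^ L j)%N => a1 a2 B.
move=> h1 h2 lt2 lt1.
(* The two codes lie in [[0, B)] and differ by a multiple of [B], so they are equal. *)
have : (a1%:Z - a2%:Z = (N2 - N1) * B%:Z) by move: h1 h2; lia.
case: (ltrgtP (N2 - N1) 0) => [||->]; last by rewrite mul0r; lia.
  by move: (N2 - N1) => k k0 h; nia.
by move: (N2 - N1) => k k0 h; nia.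
Qed.
End TorusCover.

(** * The spectral radius *)

Section SpectralGrowth.
Variables (R : realType) (m : nat -> nat) (r : nat).
Variable G : labelled_graph (digits m r).
Let A := adjacency R G.
Hypotheses (primA : primitive_mx A) (G_rr : right_resolving G).

Lemma sofic_systemE : sofic_system G = (fun p k => label (p k)) @` [set p | @is_path _ G p].
Proof. by apply/seteqP; split=> [x [p pP ->]|_ [p pP <-]]; exists p. Qed.

(** From a fixed starting vertex, right-resolvingness recovers the edges one by one from the
    labels. *)
Lemma nvals_paths_from_le n u :
  (nvals (paths_from u) (@prefix_of (edge G) n) <= nwords G r n)%N.
Proof.
apply: (leq_nvals (g := fun p k => label (p k))) => [p [pP _]|p q [pP pu] [qP qu]].
  by exists p.
move=> /word_cubeP pq; have lpq k : (k < n)%N -> label (p k) = label (q k).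
  by move=> kn; apply/ffunP => j; exact: pq.
apply/prefix_ofP; elim=> [|k IHk] kn; apply: G_rr; rewrite ?lpq //.
  by rewrite pu qu.
by rewrite -pP -qP IHk // ltnW.
Qed.

Lemma nwords_le_paths n :
  (nwords G r n <= \sum_u nvals (paths_from u) (@prefix_of (edge G) n))%N.
Proof.
pose pre p := (src (p 0%N), prefix_of n p) : vertex G * {ffun 'I_n -> edge G}.
rewrite /nwords /ncubes sofic_systemE nvals_image.
apply: (@leq_trans (nvals [set p | @is_path _ G p] pre)).
  apply: (leq_nvals (g := id)) => // p q _ _ [_ /prefix_ofP pq].
  by apply/word_cubeP => j k _ kn /=; rewrite pq.
rewrite (nvals_partition (c := fun p : nat -> edge G => src (p 0%N))); last first.
  by move=> p q _ _ [].
apply: leq_sum => u _; apply: (leq_nvals (g := id)) => // p q [pP /= pu] [qP /= qu] /= pq.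
by rewrite /pre pu qu pq.
Qed.

Lemma sum_paths n : (\sum_u nvals (paths_from u) (@prefix_of (edge G) n))%:R =
  \sum_i \sum_j (A ^+ n) i j :> R.
Proof.
rewrite natr_sum (reindex_onto (@enum_val (vertex G) predT) enum_rank) /=; last first.
  by move=> u _; rewrite enum_rankK.
rewrite (eq_bigl predT) => [|i]; last by rewrite enum_valK eqxx.
apply: eq_bigr => i _; rewrite (nvals_paths_from (R := R)) // enum_valK mxE.
by apply: eq_bigr => j _; rewrite mxE mulr1.
Qed.

(** [rho^n / #|V| <= nwords G r n <= C rho^n], so the logarithm stays within a constant of
    [n ln rho]. *)
Lemma growth_rate_spectral (H : R) : (0 < #|vertex G|)%N ->
  (forall n, (0 < nwords G r n)%N) ->
  growth_rate (fun n => ln (nwords G r n)%:R) H ->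
  H = ln (spectral_radius A).
Proof.
move=> V0 N0 fH; set rho := spectral_radius A.
have N0R n : 0 < (nwords G r n)%:R :> R by rewrite ltr0n.
have tot_le n : rho ^+ n <= #|vertex G|%:R * (nwords G r n)%:R.
  apply: le_trans (spectral_radius_exp_le (@adjacency_ge0 R _ G) V0 n) _.
  rewrite -sum_paths -natrM ler_nat -sum_nat_const; apply: leq_sum => u _.
  exact: nvals_paths_from_le.
have [C C0 leC] := le_spectral_radius_exp (@adjacency_ge0 R _ G) V0 primA.
have N_le n : (nwords G r n)%:R <= C * rho ^+ n.
  by apply: le_trans (leC n); rewrite -sum_paths ler_nat nwords_le_paths.
(* [rho = 0] would leave no word of length [1]. *)
have rho0 : 0 < rho.
  rewrite lt_neqAle (spectral_radius_ge0 (@adjacency_ge0 R _ G) V0) andbT eq_sym.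
  apply/eqP => r0; have := lt_le_trans (N0R 1%N) (N_le 1%N).
  by rewrite r0 expr0n mulr0 ltxx.
have V0R : 0 < #|vertex G|%:R :> R by rewrite ltr0n.
apply: (growth_rate_affine (c := - ln #|vertex G|%:R) (C := ln C) fH) => n.
  rewrite addrC lerBlDl mulr_natl -lnXn // -lnM ?posrE //.
  by rewrite ler_ln ?posrE ?exprn_gt0 ?mulr_gt0.
by rewrite mulr_natl -lnXn // -lnM ?posrE ?exprn_gt0 // ler_ln ?posrE ?mulr_gt0 ?exprn_gt0.
Qed.

End SpectralGrowth.

(** * The Minkowski dimension *)

Section Minkowski.
Variables (R : realType) (m : nat -> nat) (r : nat).
Variable G : labelled_graph (digits m r).
Hypotheses (r_gt0 : (0 < r)%N) (m1 : (2 <= m 1)%N).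
Hypothesis m_le : forall i, (1 <= i < r)%N -> (m i <= m i.+1)%N.

Lemma m_mono i j : (i <= j)%N -> (j < r)%N -> (m i.+1 <= m j.+1)%N.
Proof.
elim: j => [|j IHj]; first by rewrite leqn0 => /eqP ->.
rewrite leq_eqVlt => /predU1P[->//|ij jr]; apply: leq_trans (IHj ij (ltnW jr)) _.
exact: m_le.
Qed.

Lemma m_ge2 j : (j < r)%N -> (2 <= m j.+1)%N.
Proof. by move=> jr; apply: leq_trans m1 _; exact: m_mono. Qed.

Lemma ln_m_gt0 j : (j < r)%N -> 0 < ln (m j.+1)%:R :> R.
Proof. by move=> jr; rewrite ln_gt0 // ltr1n m_ge2. Qed.

(** The least length with [m_j^(-L)] strictly below [e / r], for small [e]; the value [0] from [r]
    on closes the last block. *)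
Definition scale (e : R) (j : nat) : nat :=
  if (j < r)%N then (Num.truncn (ln (r%:R / e) / ln (m j.+1)%:R)).+1 else 0%N.

(** The value [0] at [r] makes the leading term [1 / log m_r] one more difference of the sum. *)
Definition inv_ln (j : nat) : R := if (j < r)%N then (ln (m j.+1)%:R)^-1 else 0.

Section FixedScale.
Variable e : R.
Hypotheses (e_gt0 : 0 < e) (e_lt1 : e < 1).

Let re_gt0 : 0 < r%:R / e. Proof. by rewrite divr_gt0 // ltr0n. Qed.

Lemma ln_scale_ge0 : 0 <= ln (r%:R / e).
Proof.
apply: ln_ge0; rewrite ler_pdivlMr // mul1r (le_trans (ltW e_lt1)) //.
by rewrite ler1n.
Qed.

Lemma scale_mono : {homo scale e : i j / (i <= j)%N >-> (j <= i)%N}.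
Proof.
move=> i j ij; rewrite /scale; case: ifP => // jr.
rewrite (leq_ltn_trans ij jr) ltnS; apply: le_truncn.
have := ln_m_gt0 jr; have := ln_m_gt0 (leq_ltn_trans ij jr) => mi mj.
rewrite ler_wpM2l ?ln_scale_ge0 // lef_pV2 ?posrE //.
rewrite ler_ln ?posrE ?ltr0n ?ler_nat ?m_mono //; apply: ltnW; apply: m_ge2 => //.
exact: leq_ltn_trans jr.
Qed.

Lemma scale_bounds j : (j < r)%N ->
  ln (r%:R / e) * inv_ln j <= (scale e j)%:R <= ln (r%:R / e) * inv_ln j + 1.
Proof.
move=> jr; rewrite /scale /inv_ln jr ltW ?truncnS_gt //= -natr1 lerD2r.
by rewrite truncn_le divr_ge0 ?ln_scale_ge0 // ltW ?ln_m_gt0.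
Qed.

Lemma scale_ge (j : 'I_r) : r%:R <= e * (m j.+1)%:R ^+ scale e j.
Proof.
have mj := ln_m_gt0 (ltn_ord j); have m0 : 0 < (m j.+1)%:R :> R by rewrite ltr0n ltnW ?m_ge2.
rewrite mulrC -ler_pdivrMr // -ler_ln ?posrE ?exprn_gt0 // lnXn // -(mulr_natl (ln _)).
rewrite -ler_pdivrMr //; have /andP[] := scale_bounds (ltn_ord j).
by rewrite /inv_ln ltn_ord.
Qed.

(** The length overshoots by at most one digit, which costs a factor [m_j]. *)
Lemma scale_le (j : 'I_r) : e * (m j.+1)%:R ^+ scale e j <= r%:R * (m j.+1)%:R.
Proof.
have mj := ln_m_gt0 (ltn_ord j); have m0 : 0 < (m j.+1)%:R :> R by rewrite ltr0n ltnW ?m_ge2.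
rewrite mulrC -ler_pdivlMr // mulrAC.
have rem0 : 0 < r%:R / e * (m j.+1)%:R by rewrite mulr_gt0.
rewrite -ler_ln ?posrE ?exprn_gt0 // lnXn // (lnM re_gt0 m0) -(mulr_natl (ln _)).
have /andP[_] := scale_bounds (ltn_ord j).
rewrite /inv_ln ltn_ord -(ler_pM2r mj) mulrDl mulfVK ?gt_eqF // mul1r; exact.
Qed.

End FixedScale.

Lemma cvg_ln_inv : ln e^-1 @[e --> (0 : R)^'+] --> +oo.
Proof.
apply/cvgryPge => B; near=> e.
have e0 : 0 < e by near: e; exact: nbhs_right_gt.
rewrite -[B]expRK ler_ln ?posrE ?invr_gt0 ?expR_gt0 //.
rewrite -[expR B]invrK lef_pV2 ?posrE ?invr_gt0 ?expR_gt0 //.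
by near: e; apply: nbhs_right_le; rewrite invr_gt0 expR_gt0.
Unshelve. all: by end_near. Qed.

Lemma cvg_scale j : ((scale e j)%:R / ln e^-1) @[e --> (0 : R)^'+] --> inv_ln j.
Proof.
have [jr|rj] := ltnP j r; last first.
  rewrite /inv_ln ltnNge rj /=; apply: cvg_near_cst.
  by near=> e; rewrite /scale ltnNge rj mul0r.
have t0 : \forall e \near (0 : R)^'+, 0 < ln e^-1.
  by have /cvgryPgt/(_ 0) := cvg_ln_inv.
have tV : (ln e^-1)^-1 @[e --> (0 : R)^'+] --> (0 : R).
  exact/(gtr0_cvgV0 t0)/cvg_ln_inv.
have lim (c : R) : (inv_ln j + (ln r%:R * inv_ln j + c) * (ln e^-1)^-1)
    @[e --> (0 : R)^'+] --> inv_ln j.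
  have : (inv_ln j + (ln r%:R * inv_ln j + c) * (ln e^-1)^-1)
      @[e --> (0 : R)^'+] --> inv_ln j + (ln r%:R * inv_ln j + c) * 0.
    exact: cvgD (cvg_cst _) (cvgM (cvg_cst _) tV).
  by rewrite mulr0 addr0.
apply: (squeeze_cvgr _ (lim 0) (lim 1)); near=> e.
have e0 : 0 < e by near: e; exact: nbhs_right_gt.
have e1 : e < 1 by near: e; exact: nbhs_right_lt.
have te : 0 < ln e^-1 by near: e.
have E c : inv_ln j + c * (ln e^-1)^-1 = (ln e^-1 * inv_ln j + c) / ln e^-1.
  by rewrite mulrDl mulrAC divff ?mul1r // gt_eqF.
rewrite !E !ler_pM2r ?invr_gt0 //.
have := scale_bounds e0 e1 jr; rewrite lnM ?posrE ?invr_gt0 ?ltr0n // mulrDl.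
lra.
Unshelve. all: by end_near. Qed.

End Minkowski.

Lemma ln_prod (R : realType) (I : finType) (F : I -> nat) :
  (forall i, (0 < F i)%N) -> ln (\prod_i F i)%:R = \sum_i ln (F i)%:R :> R.
Proof.
move=> F0; rewrite natr_prod.
suff [_ ->] : 0 < \prod_i (F i)%:R :> R /\ ln (\prod_i (F i)%:R) = \sum_i ln (F i)%:R :> R by [].
elim/big_rec2: _ => [|i y x _ [x0 <-]]; first by rewrite ln1.
by rewrite lnM ?posrE ?ltr0n // mulr_gt0 ?ltr0n.
Qed.

Section MinkowskiLimit.
Variables (R : realType) (m : nat -> nat) (r : nat).
Variable G : labelled_graph (digits m r).
Hypotheses (r_gt0 : (0 < r)%N) (m1 : (2 <= m 1)%N).
Hypothesis m_le : forall i, (1 <= i < r)%N -> (m i <= m i.+1)%N.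
Hypothesis S_neq0 : sofic_system G !=set0.
Variables (k : nat) (H : nat -> R).
Hypothesis prependsG : prepends G k.
Hypothesis growthH : forall i, growth_rate (fun n => ln (nwords G i n)%:R) (H i).

Let nw_gt0 i n : (0 < nwords G i n)%N.
Proof. exact: nvals_gt0. Qed.

Let len (e : R) (j : nat) : nat := (scale m r e j - scale m r e j.+1)%N.
Let total (e : R) : R := \sum_(j < r) ln (nwords G j.+1 (len e j))%:R.

(** Block lengths grow like [ln e^-1] times a difference of inverse logarithms; if two consecutive
    bases agree, the coefficient is [0]. *)
Lemma cvg_total : total e / ln e^-1 @[e --> (0 : R)^'+] -->
  \sum_(j < r) (inv_ln R m r j - inv_ln R m r j.+1) * H j.+1.
Proof.
under eq_fun do rewrite /total mulr_suml.
apply: cvg_big => [|j _]; first exact: add_continuous.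
apply: (@growth_rate_cvg _ _ (0^'+) _ _ _ _ (len ^~ j) (fun e => ln e^-1) (growthH j.+1)).
  exact: cvg_ln_inv.
have : ((scale m r e j)%:R / ln e^-1 - (scale m r e j.+1)%:R / ln e^-1)
    @[e --> (0 : R)^'+] --> inv_ln R m r j - inv_ln R m r j.+1.
  by apply: cvgB; apply: cvg_scale.
apply: cvg_trans; apply: near_eq_cvg; near=> e.
have e0 : 0 < e by near: e; exact: nbhs_right_gt.
have e1 : e < 1 by near: e; exact: nbhs_right_lt.
by rewrite /len natrB ?mulrBl // (scale_mono r_gt0 m1 m_le e0 e1).
Unshelve. all: by end_near. Qed.

(** The error from the gaps is independent of [e], so it vanishes after division by [ln e^-1]. *)
Lemma total_bounds e : 0 < e -> e < 1 ->
  ln (ncubes G (scale m r e))%:R <= total e <=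
  ln (ncubes G (scale m r e))%:R + \sum_(j < r) ln (nwords G j.+1 k)%:R.
Proof.
move=> e0 e1; have sm := scale_mono r_gt0 m1 m_le e0 e1.
have sr : scale m r e r = 0%N by rewrite /scale ltnn.
have nc0 : (0 < ncubes G (scale m r e))%N by exact: nvals_gt0.
rewrite /total -!ln_prod //; apply/andP; split.
  rewrite ler_ln ?posrE ?ltr0n ?prodn_gt0 // ler_nat.
  exact: (ncubes_le_prod _ sr).
rewrite -lnM ?posrE ?ltr0n ?prodn_gt0 // -natrM ler_ln ?posrE ?ltr0n ?muln_gt0 ?nc0 ?prodn_gt0 //.
rewrite ler_nat; apply: leq_trans (_ : _ <= \prod_(j < r) nwords G j.+1 (len e j - k) *
  \prod_(j < r) nwords G j.+1 k)%N _.
  by rewrite -big_split /=; apply: leq_prod => j _; exact: nwordsB.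
by rewrite leq_mul2r (prod_le_ncubes sm) ?orbT.
Qed.

Lemma minkowski_limit :
  has_minkowski_dim (@flat_dist R r) (@digit_map R r m @` sofic_system G)
    (\sum_(j < r) (inv_ln R m r j - inv_ln R m r j.+1) * H j.+1)%:E.
Proof.
(* [E] dominates [2 r m_j] for every [j] at once; [c] collects the cubes met by one ball and the
   loss from the gaps. *)
pose E := (\sum_(j < r) 2 * r * m j.+1)%N.
pose c := ln ((E + E + 4).+1 ^ r)%:R + \sum_(j < r) ln (nwords G j.+1 k)%:R : R.
have M0 : 0 < ((E + E + 4).+1 ^ r)%:R :> R by rewrite ltr0n expn_gt0.
have t0 : \forall e \near (0 : R)^'+, 0 < ln e^-1.
  by have /cvgryPgt/(_ 0) := @cvg_ln_inv R.
apply: (@squeeze_cvge _ _ _ _ (fun e => ((total e - c) / ln e^-1)%:E) _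
    (fun e => (total e / ln e^-1)%:E)).
- near=> e.
  have e0 : 0 < e by near: e; exact: nbhs_right_gt.
  have e1 : e < 1 by near: e; exact: nbhs_right_lt.
  have te : 0 < ln e^-1 by near: e.
  rewrite !EFinM !lee_pmul2r ?lte_fin ?invr_gt0 //.
  have /andP[l1 l2] := total_bounds e0 e1.
  have nc0 : 0 < (ncubes G (scale m r e))%:R :> R by rewrite ltr0n nvals_gt0.
  apply/andP; split; last first.
    apply: (@le_trans _ _ (ln (ncubes G (scale m r e))%:R)%:E); last by rewrite lee_fin.
    apply: lne_le_EFin => //; first exact: cover_number_ge0.
    apply: cover_number_le_ncubes; last exact: ltW.
    by move=> j; exact: scale_ge.
  apply: (@le_trans _ _ (ln ((ncubes G (scale m r e))%:R / ((E + E + 4).+1 ^ r)%:R))%:E).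
    rewrite lee_fin ln_div ?posrE // /c; lra.
  apply: le_lne_EFin; first exact: divr_gt0.
  apply: ncubes_le_cover_number => // j.
  rewrite -mulrA; apply: (@le_trans _ _ (2 * (r%:R * (m j.+1)%:R))).
    by rewrite ler_pM2l // scale_le.
  by rewrite -!natrM ler_nat /E (bigD1 j) //= mulnA leq_addr.
- apply: cvg_EFin; first by near=> e.
  have tV : (ln e^-1)^-1 @[e --> (0 : R)^'+] --> (0 : R).
    exact/(gtr0_cvgV0 t0)/cvg_ln_inv.
  have : (total e / ln e^-1 - c * (ln e^-1)^-1) @[e --> (0 : R)^'+] -->
      \sum_(j < r) (inv_ln R m r j - inv_ln R m r j.+1) * H j.+1 - c * 0.
    exact: cvgB cvg_total (cvgM (cvg_cst _) tV).
  rewrite mulr0 subr0; apply: cvg_trans; apply: near_eq_cvg; near=> e.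
  by rewrite /= mulrBl.
- by apply: cvg_EFin; [near=> e|exact: cvg_total].
Unshelve. all: by end_near. Qed.

End MinkowskiLimit.

Theorem proposition2p7 (R : realType) (r : nat) (m : nat -> nat)
    (G : labelled_graph (digits m r)) :
  (1 <= r)%N ->
  (2 <= m 1%N)%N ->
  (forall i, (1 <= i < r)%N -> (m i <= m i.+1)%N) ->
  (0 < #|vertex G|)%N ->
  right_resolving G ->
  primitive_mx (adjacency R G) ->
  let S := sofic_system G in
  let h (i : nat) (le_ir : (i <= r)%N) : \bar R :=
    top_entropy R (@shift m i) (trunc_seq le_ir @` S) in
  has_minkowski_dim (@flat_dist R r) (@digit_map R r m @` S)
    (((ln (m r)%:R)^-1)%:E * top_entropy R (@shift m r) S
     + \sum_(i < r | (1 <= i)%N)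
         ((ln (m i)%:R)^-1 - (ln (m i.+1)%:R)^-1)%:E * h i (ltnW (ltn_ord i)))%E
  /\ top_entropy R (@shift m r) S
     = (ln (spectral_radius (adjacency R G)))%:E.
Proof.
move=> r_gt0 m1 m_le V0 G_rr primA S h.
have [k kG] := primitive_prepends primA.
have S_neq0 : S !=set0.
  have [u _] := card_gt0P V0; have [p [pP _]] := primitive_path primA u.
  by exists (fun n => label (p n)), p.
have nw_gt0 i n : (0 < nwords G i n)%N by exact: nvals_gt0.
have /choice[H growthH] : forall i, exists H : R,
    growth_rate (fun n => ln (nwords G i n)%:R) H.
  move=> i; apply: subadditive_growth_rate => [n|a b].
    by rewrite ln_ge0 // ler1n.
  rewrite -lnM ?posrE ?ltr0n // -natrM ler_ln ?posrE ?ltr0n ?muln_gt0 ?nw_gt0 //.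
  by rewrite ler_nat nwordsD.
have hE i le_ir : h i le_ir = (H i)%:E by exact: top_entropy_trunc.
have SE : trunc_seq (leqnn r) @` S = S.
  apply/seteqP; split=> [_ [x Sx <-]|x Sx]; first by rewrite trunc_seq_id.
  by exists x => //; exact: trunc_seq_id.
have hr : top_entropy R (@shift m r) S = (H r)%:E by rewrite -(hE r (leqnn r)) /h SE.
split; last by rewrite hr (growth_rate_spectral primA G_rr V0 (nw_gt0 r) (growthH r)).
have := minkowski_limit r_gt0 m1 m_le S_neq0 kG growthH.
congr (has_minkowski_dim _ _ _).
rewrite hr (eq_bigr (fun i : 'I_r =>
  (((ln (m i)%:R)^-1 - (ln (m i.+1)%:R)^-1) * H i)%:E)); last first.
  by move=> i _; rewrite hE.
rewrite sumEFin -EFinM -EFinD; congr (_%:E).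
move: r_gt0 => {m_le V0 G_rr primA S h kG S_neq0 nw_gt0 growthH hE SE hr}.
(* The last term of the sum from [0] is the one with [1 / log m_r]; on the other side the term
   [i = 0] drops out. *)
case: r G => [//|r'] G _.
rewrite big_ord_recr [in RHS]big_mkcond /= big_ord_recl /= add0r addrC.
rewrite /inv_ln ltnn ltnSn subr0; congr (_ + _); apply: eq_bigr => i _.
by rewrite !ltnS ltnW // ltn_ord.
Qed.
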